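(* Let $\boldsymbol{w}=(w_j)_{j\ge1}$ be a sequence in $\mathbb{N}_0$ with $0=w_1\le w_2\le\cdots$, and let $\boldsymbol{\gamma}=(\gamma_j)_{j\ge1}$ be positive product weights. (1) Suppose $\sum_{j\ge1}\gamma_j2^{w_j}<\infty$. For $d,m\in\mathbb{N}$ and $N=2^m$, denote by $\boldsymbol{z}=(Y_1z_1,\ldots,Y_dz_d)$ the generating vector constructed by the reduced CBC-DBD algorithm run for the weights $\boldsymbol{\gamma}$. Then, for any $\delta>0$ and each $\alpha>1$, the generating vector $\boldsymbol{z}$ satisfies $$e_{N,d,\alpha,\boldsymbol{\gamma}^{\alpha}}(\boldsymbol{z})\le\frac{1}{N^{\alpha}}\left(C_1(\boldsymbol{\gamma}^{\alpha})+C_2(\boldsymbol{\gamma},\delta)N^{\alpha\delta}\right)$$ with weight sequence $\boldsymbol{\gamma}^{\alpha}=(\gamma_j^{\alpha})_{j\ge1}$ and positive constants $C_1(\boldsymbol{\gamma}^{\alpha})$ and $C_2(\boldsymbol{\gamma},\delta)$ (for the given $\alpha$, $\delta$, $\boldsymbol{\gamma}$, $\boldsymbol{w}$) which are independent of $d$ and $N$. (2) Let $\alpha>1$ and suppose $\sum_{j\ge1}\gamma_j^{1/\alpha}2^{w_j}<\infty$. For $d,m\in\mathbb{N}$ and $N=2^m$, let $\widetilde{\boldsymbol{z}}=(Y_1\widetilde z_1,\ldots,Y_d\widetilde z_d)$ be the generating vector constructed by the reduced CBC-DBD algorithm run for the weights $\boldsymbol{\gamma}^{1/\alpha}=(\gamma_j^{1/\alpha})_{j\ge1}$.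 Then, for any $\delta>0$, $$e_{N,d,\alpha,\boldsymbol{\gamma}}(\widetilde{\boldsymbol{z}})\le\frac{1}{N^{\alpha}}\left(F_1(\boldsymbol{\gamma})+F_2(\boldsymbol{\gamma}^{1/\alpha},\delta)N^{\alpha\delta}\right)$$ with positive constants $F_1(\boldsymbol{\gamma})$ and $F_2(\boldsymbol{\gamma}^{1/\alpha},\delta)$ (for the given $\alpha$, $\delta$, $\boldsymbol{\gamma}$, $\boldsymbol{w}$) which are independent of $d$ and $N$.
   Context: Notation: $\mathbb{N}=\{1,2,\ldots\}$, $\mathbb{N}_0=\{0,1,\ldots\}$, $[d]=\{1,\ldots,d\}$, $\log$ is the natural logarithm, $Y_j:=2^{w_j}$, $d^*:=\max\{j\in[d]:w_j<m\}$, product weights means $\gamma_{\mathfrak{u}}:=\prod_{j\in\mathfrak{u}}\gamma_j$ with $\gamma_\emptyset=1$. For $a\in\mathbb{Z}$, $\delta_N(a)=1$ if $a\equiv0\pmod N$ and $\delta_N(a)=0$ otherwise. For $\alpha>1$, a positive weight sequence $\boldsymbol{\gamma}$ and $\boldsymbol{\ell}\in\mathbb{Z}^d$, $r_{\alpha,\boldsymbol{\gamma}}(\boldsymbol{\ell}):=\prod_{j\in[d],\,\ell_j\neq0}\gamma_j^{-1}|\ell_j|^{\alpha}$ (empty product equal to $1$). The space $E_{d,\boldsymbol{\gamma}}^{\alpha}$ consists of the one-periodic real-valued $L_2$ functions $f$ on $[0,1]^d$ with absolutely convergent Fourier series and $\|f\|:=\sup_{\boldsymbol{\ell}\in\mathbb{Z}^d}|\hat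 f(\boldsymbol{\ell})|\,r_{\alpha,\boldsymbol{\gamma}}(\boldsymbol{\ell})<\infty$. The worst-case error in (the unit ball of) this space of the $N$-point rank-1 lattice rule $f\mapsto\frac1N\sum_{k=0}^{N-1}f(\{k\boldsymbol{z}/N\})$ with generating vector $\boldsymbol{z}\in\mathbb{Z}^d$ is $$e_{N,d,\alpha,\boldsymbol{\gamma}}(\boldsymbol{z})=\sum_{\boldsymbol{0}\neq\boldsymbol{\ell}\in\mathbb{Z}^d}\frac{\delta_N(\boldsymbol{\ell}\cdot\boldsymbol{z})}{r_{\alpha,\boldsymbol{\gamma}}(\boldsymbol{\ell})}.$$ Quality function: for $1\le s\le d^*$, $1\le v\le m-w_s$, odd $x\in\mathbb{N}$ and given odd $z_1,\ldots,z_{s-1}$ with $z_j\in\{1,3,\ldots,2^{m-w_j}-1\}$, $$h_{s,v,m,\boldsymbol{\gamma},\boldsymbol{w}}(x):=\sum_{t=v}^{m-w_s}\frac{1}{2^{t-v}}\sum_{\ell=0}^{2^{w_s}-1}\ \sum_{\substack{k=\ell2^t+1 \\ k\ \mathrm{odd}}}^{(\ell+1)2^t-1}\ \sum_{\substack{\mathfrak{u}\subseteq[s] \\ s\in\mathfrak{u}}}\gamma_{\mathfrak{u}\setminus\{s\}}\prod_{\substack{j\in\mathfrak{u} \\ j\neq s}}\log\left(\frac{1}{\sin^2\left(\pi z_j\frac{k}{2^t}\frac{2^{m-w_s}}{2^{m-w_j}}\right)}\right)\left(1+\gamma_s\log\left(\frac{1}{\sin^2(\pi kx/2^v)}\right)\right).$$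 Reduced CBC-DBD algorithm (input $m,d,\boldsymbol{w}$ and a positive weight sequence $\boldsymbol{\gamma}$, the weights ''for which it is run''): set $z_1=1$, and set $z_j=1$ for $d^*<j\le d$. For $s=2,\ldots,d^*$ successively: set $z_{s,1}=1$; for $v=2,\ldots,m-w_s$ successively, let $z^*\in\{0,1\}$ be a minimizer of $z\mapsto h_{s,v,m,\boldsymbol{\gamma},\boldsymbol{w}}(z_{s,v-1}+z2^{v-1})$ over $\{0,1\}$ (computed with the already determined $z_1,\ldots,z_{s-1}$) and set $z_{s,v}=z_{s,v-1}+z^*2^{v-1}$; finally set $z_s=z_{s,m-w_s}$. Output $\boldsymbol{z}=(Y_1z_1,\ldots,Y_dz_d)$. *)

(* Defs.v *)
(* Sequences (w_j), (gamma_j), (z_j), j >= 1, are indexed from 0: index j here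
   is the index j + 1 of the usual notation, and [d] is 'I_d. *)
From HB Require Import structures.
From mathcomp Require Import all_boot all_order all_algebra.
From mathcomp Require Import all_classical all_reals all_analysis.
Set Implicit Arguments.
Unset Strict Implicit.
Unset Printing Implicit Defensive.
Import Order.TTheory GRing.Theory Num.Theory.
Local Open Scope ring_scope.

Definition decay (R : realType) (alpha : R) (g : nat -> R) (d : nat)
    (l : 'rV[int]_d) : R :=
  \prod_(j < d | l 0 j != 0) ((g j)^-1 * `|(l 0 j)%:~R| `^ alpha).

Definition dotz (d : nat) (l z : 'rV[int]_d) : int :=
  \sum_(j < d) l 0 j * z 0 j.

(* Worst-case error, in the unit ball of the space of one-periodic functions f
   with sup_l |f^(l)| * decay alpha g l finite, of the N-point rank-1 lattice
   rule with generating vector z, as the sum of 1 / decay over the nonzero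
   elements of the dual lattice.  It is an extended real: an upper bound by a
   real number includes the convergence of the sum. *)
Definition wce (R : realType) (N d : nat) (alpha : R) (g : nat -> R)
    (z : 'rV[int]_d) : \bar R :=
  (\esum_(l in [set l : 'rV[int]_d | l != 0%R])
     (((N%:Z %| dotz l z)%Z)%:R / decay alpha g l)%:E)%E.

Definition prod_weight (R : realType) (g : nat -> R) (n : nat)
    (u : {set 'I_n}) : R :=
  \prod_(j in u) g j.

Definition log_inv_sin2 (R : realType) (x : R) : R :=
  ln (1 / sin (pi * x) ^+ 2).

(* h_{s+1,v,m,g,w}(x).  The subsets u of [s+1] containing s+1 are the
   u : {set 'I_s.+1} containing ord_max; only z 0, ..., z s.-1 are used. *)
Definition quality (R : realType) (g : nat -> R) (w : nat -> nat) (m : nat)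
    (z : nat -> nat) (s v x : nat) : R :=
  \sum_(v <= t < (m - w s).+1) 1 / 2%:R ^+ (t - v) *
    \sum_(0 <= l < 2 ^ w s)
      \sum_(l * 2 ^ t + 1 <= k < l.+1 * 2 ^ t | odd k)
        \sum_(u : {set 'I_s.+1} | ord_max \in u)
          prod_weight g (u :\ ord_max) *
          (\prod_(j in u :\ ord_max)
             log_inv_sin2 ((z j)%:R * (k%:R / 2%:R ^+ t) *
                           (2%:R ^+ (m - w s) / 2%:R ^+ (m - w j)))) *
          (1 + g s * log_inv_sin2 (k%:R * x%:R / 2%:R ^+ v)).

(* d^*: an index j (from 0) is at most d^* in the usual numbering iff
   j < dstar w m d. *)
Definition dstar (w : nat -> nat) (m d : nat) : nat :=
  \max_(j < d | (w j < m)%N) j.+1.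

(* zs is a possible outcome of the digit-by-digit construction of component s
   from z 0, ..., z s.-1, where y v is z_{s,v}.  The minimizing digit b need
   not be unique, hence a relation. *)
Definition dbd_component (R : realType) (g : nat -> R) (w : nat -> nat)
    (m : nat) (z : nat -> nat) (s zs : nat) : Prop :=
  exists y : nat -> nat,
    [/\ y 1%N = 1%N,
        forall v : nat, (2 <= v <= m - w s)%N ->
          exists b : bool,
            (forall b' : bool,
               quality g w m z s v (y v.-1 + b * 2 ^ v.-1)%N <=
               quality g w m z s v (y v.-1 + b' * 2 ^ v.-1)%N) /\
            y v = (y v.-1 + b * 2 ^ v.-1)%N
      & zs = y (m - w s)%N].

(* Z is a possible output of the reduced CBC-DBD algorithm run for the
   weights g. *)
Definition reduced_cbc_dbd (R : realType) (g : nat -> R) (w : nat -> nat)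
    (m d : nat) (Z : 'rV[int]_d) : Prop :=
  exists z : nat -> nat,
    [/\ z 0%N = 1%N,
        forall j : nat, (dstar w m d <= j < d)%N -> z j = 1%N,
        forall s : nat, (1 <= s < dstar w m d)%N ->
          dbd_component g w m z s (z s)
      & Z = \row_(j < d) (2 ^ w j * z j)%N%:Z].

(* Main.v *)
Require Import Defs.
From HB Require Import structures.
From mathcomp Require Import all_boot all_order all_algebra.
From mathcomp Require Import all_classical all_reals all_analysis.
From mathcomp Require Import ring lra zify.
Set Implicit Arguments.
Unset Strict Implicit.
Unset Printing Implicit Defensive.
Import Order.TTheory GRing.Theory Num.Theory.
Local Open Scope ring_scope.

(** Both claims are one estimate for the weights g for which the search is run
    (g = gamma, resp. g = gamma^(1/alpha)), the error being that of smoothness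
    alpha and weights g^alpha: a sum, over the nonzero l of the dual lattice, of
    the alpha-th powers of b(l) = prod_(l_j <> 0) g_j / |l_j|.  Put N = 2^m, let
    Z_j = 2^w_j z_j be the components found, and L(x) = - ln sin^2(pi x).

    The dual points with some |l_j| > N contribute O(N^-alpha): along that
    coordinate each block of N consecutive integers meets every residue at most
    2^w_j times, and the sum of the g_j 2^w_j is finite ([lattice_sum_tail],
    [outside_box_le]).  Over the other points the sum of the powers is at most
    the power of the sum T of the b(l) ([lattice_sum_nz_powR]), so it remains
    to bound T by a constant times N^(delta - 1).

    By orthogonality of characters, T is bounded by a mean over k < N of
    products over j of cosine polynomials at k Z_j / N.  The coefficients
    1 / |l| are enlarged to rho^(|l| - N) / |l| with rho = 1 - N^-2, and the
    constant term to about ln 4, the mean of L.  The resulting polynomial is at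
    most L + O(m / N), because log (4 / |1 - rho e^(2 pi i x)|^2) is at most
    - ln (rho sin^2(pi x)); it is nonnegative and O(m) everywhere
    ([damped_log_kernel]).  The point l = 0 now accounts for at least
    prod_j (1 + g_j ln 4), so that T is at most the excess of the mean of
    prod_j (1 + g_j L(k Z_j / N)) over this product, up to a relative error
    O(m / N).

    That mean is what the search controls.  Averaging over the two values of a
    digit replaces L(x) by (ln 4 + L(2 x)) / 2, and with the weights 2^-(t - v)
    of the quality function the resulting inequalities telescope
    ([digit_telescope], [dbd_component_average]): over the k at which component
    s is nonsingular, its factor raises the sum by a factor at most
    1 + g_s ln 4.  There are at most 2^w_s other values of k; each costs
    O(g_s m) times prod_j (1 + 14 g_j m), and that product is O(N^delta) because
    the g_j are summable ([sum_truncated_product], [prod_growth]).  Altogether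
    T = O(m N^(delta - 1)) ([box_sum_le]). *)

(** * The logarithm of the squared sine at dyadic points *)

Section LogSine.
Context {R : realType}.
Local Notation L := (@log_inv_sin2 R).
Implicit Types (x y : R) (k n t : nat).

Lemma sin2_le1 x : sin x ^+ 2 <= 1.
Proof. by rewrite sin2cos2 gerBl sqr_ge0. Qed.

Lemma log_inv_sin2E x : L x = - ln (sin (pi * x) ^+ 2).
Proof.
rewrite /log_inv_sin2 div1r; have [->|s0] := eqVneq (sin (pi * x)) 0.
  by rewrite expr0n /= invr0 !ln0 ?oppr0.
by rewrite lnV // posrE exprn_even_gt0.
Qed.

Lemma log_inv_sin2_ge0 x : 0 <= L x.
Proof. by rewrite log_inv_sin2E oppr_ge0 ln_le0 // sin2_le1. Qed.

Lemma sin2_period x n : sin (pi * (x + n%:R)) ^+ 2 = sin (pi * x) ^+ 2.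
Proof.
elim: n => [|n <-]; first by rewrite addr0.
by rewrite -natr1 addrA mulrDr mulr1 sinDpi sqrrN.
Qed.

Lemma log_inv_sin2_period x n : L (x + n%:R) = L x.
Proof. by rewrite !log_inv_sin2E sin2_period. Qed.

Lemma sin2_half_odd k : odd k -> sin (pi * (k%:R / 2)) ^+ 2 = 1 :> R.
Proof.
move=> ko; have -> : k%:R / 2 = 1 / 2 + k./2%:R :> R.
  by rewrite -{1}[k]odd_double_half ko natrD -mul2n natrM /=; field.
by rewrite sin2_period mul1r sin_pihalf expr1n.
Qed.

Lemma log_inv_sin2_half_odd k : odd k -> L (k%:R / 2) = 0.
Proof. by move=> ko; rewrite log_inv_sin2E sin2_half_odd // ln1 oppr0. Qed.

Lemma sin2_double x :
  sin (pi * (2 * x)) ^+ 2 = 4 * sin (pi * x) ^+ 2 * sin (pi * (x + 1 / 2)) ^+ 2.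
Proof.
have -> : pi * (2 * x) = (pi * x) *+ 2 by rewrite mulr2n; ring.
have -> : pi * (x + 1 / 2) = pi * x + pi / 2 by ring.
by rewrite sin_mulr2n sinDpihalf mulr2n; ring.
Qed.

(** The logarithm of sin 2t = 2 sin t cos t.  Since adding 2^(v-1) to x shifts
    k x / 2^v by 1/2 modulo 1 for odd k, this is the identity behind the average
    over one digit. *)
Lemma log_inv_sin2_double x : sin (pi * (2 * x)) != 0 ->
  L x + L (x + 1 / 2) = ln 4 + L (2 * x).
Proof.
move=> s0; have := sin2_double x; rewrite !log_inv_sin2E => e.
have p0 : 0 < sin (pi * (2 * x)) ^+ 2 by rewrite exprn_even_gt0.
have p1 : 0 < sin (pi * x) ^+ 2.
  rewrite exprn_even_gt0 //=; apply: contra_neq s0 => s0.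
  by apply/eqP; rewrite -sqrf_eq0 e s0 expr0n /= ?(mulr0, mul0r).
have p2 : 0 < sin (pi * (x + 1 / 2)) ^+ 2.
  rewrite exprn_even_gt0 //=; apply: contra_neq s0 => s0.
  by apply/eqP; rewrite -sqrf_eq0 e s0 expr0n /= ?(mulr0, mul0r).
have q0 : (0 : R) < 4 by [].
have -> : ln (sin (pi * (2 * x)) ^+ 2) =
    ln 4 + ln (sin (pi * x) ^+ 2) + ln (sin (pi * (x + 1 / 2)) ^+ 2).
  by rewrite e -!lnM // posrE mulr_gt0.
lra.
Qed.

(** Halving the argument at most halves the sine, and an odd multiple of 1/2
    gives the value 1 to start from. *)
Lemma sin2_dyadic_ge t k : ~~ (2 ^ t %| k)%N ->
  1 <= 4 ^+ t * sin (pi * (k%:R / 2 ^+ t)) ^+ 2 :> R.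
Proof.
elim: t k => [|t IH] k; first by rewrite expn0 dvd1n.
have [ko|ke] := boolP (odd k); last first.
  have kE : k = (k./2 * 2)%N by rewrite -{1}[k]odd_double_half (negbTE ke) muln2.
  rewrite {1}kE expnSr dvdn_pmul2r // => /IH h.
  have -> : k%:R / 2 ^+ t.+1 = k./2%:R / 2 ^+ t :> R.
    by rewrite {1}kE natrM exprSr; field; rewrite expf_neq0.
  apply: (le_trans h); rewrite ler_wpM2r ?sqr_ge0 // ler_eXn2l //; lra.
move=> _; case: t IH => [|t] IH; first by rewrite !expr1 sin2_half_odd // mulr1; lra.
have nd : ~~ (2 ^ t.+1 %| k)%N.
  by apply/negP => /(dvdn_trans (dvdn_exp (ltn0Sn t) (dvdnn 2))); rewrite dvdn2 ko.
apply: (le_trans (IH _ nd)).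
have -> : k%:R / 2 ^+ t.+1 = 2 * (k%:R / 2 ^+ t.+2) :> R.
  by rewrite [2 ^+ t.+2]exprS; field; rewrite expf_neq0.
rewrite sin2_double [4 ^+ t.+2]exprSr.
have := sin2_le1 (pi * (k%:R / 2 ^+ t.+2 + 1 / 2)).
set C := sin _ ^+ 2; set B := sin _ ^+ 2; set A := 4 ^+ t.+1 => C1.
have AB : 0 <= A * B by rewrite mulr_ge0 ?sqr_ge0 ?exprn_ge0.
have -> : A * (4 * B * C) = A * B * 4 * C by ring.
have -> : A * 4 * B = A * B * 4 by ring.
by rewrite ler_piMr // mulr_ge0.
Qed.

Lemma sin_dyadic_neq0 t k : ~~ (2 ^ t %| k)%N -> sin (pi * (k%:R / 2 ^+ t)) != 0 :> R.
Proof.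
move/sin2_dyadic_ge => h; apply/eqP => s0.
by move: h; rewrite s0 expr0n mulr0 ler10.
Qed.

Lemma log_inv_sin2_dyadic_le t k : ~~ (2 ^ t %| k)%N ->
  L (k%:R / 2 ^+ t) <= t%:R * ln 4.
Proof.
move=> h; have := sin2_dyadic_ge h; have := sin_dyadic_neq0 h.
rewrite log_inv_sin2E; set s := sin _ => s0 hs.
have p : 0 < s ^+ 2 by rewrite exprn_even_gt0.
have p4 : 0 < 4 ^+ t :> R by rewrite exprn_gt0.
have -> : t%:R * ln 4 = ln (4 ^+ t) :> R by rewrite lnXn // mulr_natl.
by have := ln_ge0 hs; rewrite lnM ?posrE //; lra.
Qed.

Lemma odd_ndvd_exp2 t k : (0 < t)%N -> odd k -> ~~ (2 ^ t %| k)%N.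
Proof.
by move=> t0 ko; apply/negP => /(dvdn_trans (dvdn_exp t0 (dvdnn 2))); rewrite dvdn2 ko.
Qed.

End LogSine.

(** * Sums over the points of a dual lattice *)

Section LatticeSums.
Context {R : realType}.
Implicit Types (phi kap : nat -> nat -> R) (Z : nat -> int) (N n s : nat) (c : int).

Lemma eq_ler (x y : R) : x = y -> x <= y.
Proof. by move=> ->. Qed.

(** The sum of prod_j phi_j(|l_j|) over the l in [-n, n]^s with N | c + l . Z.
    It is defined by recursion on the dimension because the estimates below are
    inductions on s, in which the residue c absorbs the last coordinate. *)
Fixpoint lattice_sum N n phi Z s c : R :=
  match s with
  | 0%N => ((N%:Z %| c)%Z)%:R
  | s'.+1 => phi s' 0%N * lattice_sum N n phi Z s' c +
      \sum_(a < n) phi s' a.+1 *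
        (lattice_sum N n phi Z s' (c + a.+1%:Z * Z s') +
         lattice_sum N n phi Z s' (c - a.+1%:Z * Z s'))
  end.

Definition lattice_sum_nz N n phi Z s c : R :=
  lattice_sum N n phi Z s c - ((N%:Z %| c)%Z)%:R * \prod_(j < s) phi j 0%N.

Lemma lattice_sum_nzS N n phi Z s c :
  lattice_sum_nz N n phi Z s.+1 c = phi s 0%N * lattice_sum_nz N n phi Z s c +
      \sum_(a < n) phi s a.+1 *
        (lattice_sum N n phi Z s (c + a.+1%:Z * Z s) +
         lattice_sum N n phi Z s (c - a.+1%:Z * Z s)).
Proof. by rewrite /lattice_sum_nz /= big_ord_recr /=; ring. Qed.

Lemma lattice_sum_nz0 N n phi Z c : lattice_sum_nz N n phi Z 0 c = 0.
Proof. by rewrite /lattice_sum_nz big_ord0 mulr1 subrr. Qed.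

Lemma lattice_sumE N n phi Z s c : lattice_sum N n phi Z s c =
  lattice_sum_nz N n phi Z s c + ((N%:Z %| c)%Z)%:R * \prod_(j < s) phi j 0%N.
Proof. by rewrite /lattice_sum_nz subrK. Qed.

Lemma lattice_sum_ge0 N n phi Z s c : (forall j a, 0 <= phi j a) ->
  0 <= lattice_sum N n phi Z s c.
Proof.
move=> p0; elim: s c => [|s IH] c /=; first exact: ler0n.
by rewrite addr_ge0 ?mulr_ge0 // sumr_ge0 // => a _; rewrite mulr_ge0 ?addr_ge0.
Qed.

Lemma lattice_sum_nz_ge0 N n phi Z s c : (forall j a, 0 <= phi j a) ->
  0 <= lattice_sum_nz N n phi Z s c.
Proof.
move=> p0; elim: s => [|s IH]; first by rewrite lattice_sum_nz0.
rewrite lattice_sum_nzS addr_ge0 ?mulr_ge0 // sumr_ge0 // => a _.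
by rewrite mulr_ge0 ?addr_ge0 ?lattice_sum_ge0.
Qed.

Lemma lattice_sum_period N n phi Z s c q :
  lattice_sum N n phi Z s (c + q * N%:Z) = lattice_sum N n phi Z s c.
Proof.
elim: s c => [|s IH] c /=.
  by rewrite rpredDr // dvdz_mull.
rewrite IH; congr (_ + _); apply: eq_bigr => a _.
by rewrite -![_ + q * _ + _]addrA ![q * _ + _]addrC ![_ + (_ + q * _)]addrA !IH.
Qed.

Lemma ler_sum_ord_widen (F G : nat -> R) n n' : (n <= n')%N ->
  (forall a, (a < n)%N -> F a <= G a) -> (forall a, 0 <= G a) ->
  \sum_(a < n) F a <= \sum_(a < n') G a.
Proof.
move=> nn FG G0; rewrite (big_ord_widen n' _ nn) big_mkcond /=.
by apply: ler_sum => a _; case: ifP => // an; apply: FG.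
Qed.

Lemma lattice_sum_nz_le N n n' phi kap Z s c : (n <= n')%N ->
  (forall j a, 0 <= phi j a) -> (forall j a, 0 <= kap j a) ->
  (forall j a, (a <= n)%N -> phi j a <= kap j a) ->
  lattice_sum_nz N n phi Z s c <= lattice_sum_nz N n' kap Z s c.
Proof.
move=> nn p0 k0 pk.
have [//] : lattice_sum_nz N n phi Z s c <= lattice_sum_nz N n' kap Z s c /\
  lattice_sum N n phi Z s c <= lattice_sum N n' kap Z s c.
elim: s c => [|s IH] c; first by rewrite !lattice_sum_nz0.
have nz : lattice_sum_nz N n phi Z s.+1 c <= lattice_sum_nz N n' kap Z s.+1 c.
  rewrite !lattice_sum_nzS lerD //.
    by rewrite ler_pM ?lattice_sum_nz_ge0 ?pk //; case: (IH c).
  apply: (ler_sum_ord_widen (F := fun a => phi s a.+1 *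
         (lattice_sum N n phi Z s (c + a.+1%:Z * Z s) +
          lattice_sum N n phi Z s (c - a.+1%:Z * Z s)))
       (G := fun a => kap s a.+1 *
         (lattice_sum N n' kap Z s (c + a.+1%:Z * Z s) +
         lattice_sum N n' kap Z s (c - a.+1%:Z * Z s)))) => // a.
    move=> an; rewrite ler_pM ?addr_ge0 ?lattice_sum_ge0 ?pk //.
    by rewrite lerD //; [case: (IH (c + a.+1%:Z * Z s))|case: (IH (c - a.+1%:Z * Z s))].
  by rewrite mulr_ge0 ?addr_ge0 ?lattice_sum_ge0.
split=> //; rewrite !lattice_sumE lerD // ler_wpM2l // ler_prod // => j _.
by rewrite p0 pk.
Qed.

Lemma powR_superadd (alpha x y : R) : 1 <= alpha -> 0 <= x -> 0 <= y ->
  x `^ alpha + y `^ alpha <= (x + y) `^ alpha.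
Proof.
move=> a1 x0 y0; have a0 : 0 < alpha by lra.
have s0 : 0 <= x + y by lra.
rewrite -(mulr_powRB1 x0 a0) -(mulr_powRB1 y0 a0) -(mulr_powRB1 s0 a0) mulrDl.
by rewrite lerD // ler_wpM2l // ge0_ler_powR ?nnegrE //; lra.
Qed.

Lemma powR_superadd_sum (alpha : R) n (F : 'I_n -> R) : 1 <= alpha ->
  (forall i, 0 <= F i) -> \sum_(i < n) F i `^ alpha <= (\sum_(i < n) F i) `^ alpha.
Proof.
move=> a1; elim: n F => [|n IH] F F0; first by rewrite !big_ord0 powR_ge0.
rewrite !big_ord_recr /=; apply: le_trans (powR_superadd a1 _ _) => //.
  by rewrite lerD2r IH.
exact: sumr_ge0.
Qed.

(** Superadditivity of x^alpha, one coordinate at a time.  The full sums have to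
    be carried along, since a nonzero l with l_s <> 0 may vanish elsewhere. *)
Lemma lattice_sum_nz_powR N n phi Z s c alpha : 1 <= alpha ->
  (forall j a, 0 <= phi j a) -> (forall j, phi j 0%N = 1) ->
  lattice_sum_nz N n (fun j a => phi j a `^ alpha) Z s c <=
  lattice_sum_nz N n phi Z s c `^ alpha.
Proof.
move=> a1 p0 p1.
set psi := fun j a => phi j a `^ alpha.
have q0 j a : 0 <= psi j a by apply: powR_ge0.
have prod1 n0 : \prod_(j < n0) phi j 0%N = 1 by rewrite big1.
have prod2 n0 : \prod_(j < n0) psi j 0%N = 1.
  by rewrite big1 // => j _; rewrite /psi p1 powR1.
have [//] : lattice_sum_nz N n psi Z s c <= lattice_sum_nz N n phi Z s c `^ alpha /\
  lattice_sum N n psi Z s c <= lattice_sum N n phi Z s c `^ alpha.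
elim: s c => [|s IH] c.
  rewrite !lattice_sum_nz0 powR_ge0 /=; split=> //.
  by case: (_ %| _)%Z; rewrite ?powR1 // powR_ge0.
have nz : lattice_sum_nz N n psi Z s.+1 c <= lattice_sum_nz N n phi Z s.+1 c `^ alpha.
  rewrite !lattice_sum_nzS; apply: le_trans (powR_superadd a1 _ _) => //; first last.
  - by rewrite sumr_ge0 // => a _; rewrite mulr_ge0 ?addr_ge0 ?lattice_sum_ge0.
  - by rewrite mulr_ge0 ?lattice_sum_nz_ge0.
  rewrite lerD //.
    by rewrite /psi p1 powR1 !mul1r; case: (IH c).
  apply: (le_trans _ (powR_superadd_sum _ _)) => //; last first.
    by move=> a; rewrite mulr_ge0 ?addr_ge0 ?lattice_sum_ge0.
  apply: ler_sum => a _; rewrite powRM ?addr_ge0 ?lattice_sum_ge0 //.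
  rewrite ler_wpM2l //; apply: le_trans (powR_superadd a1 _ _) => //; rewrite ?lattice_sum_ge0 //.
  by rewrite lerD //; [case: (IH (c + a.+1%:Z * Z s))|case: (IH (c - a.+1%:Z * Z s))].
split=> //; rewrite !lattice_sumE prod1 prod2 !mulr1.
apply: le_trans (powR_superadd a1 _ _) => //; rewrite ?lattice_sum_nz_ge0 //.
by rewrite lerD //; case: (_ %| _)%Z; rewrite ?powR1 // powR_ge0.
Qed.

End LatticeSums.

(** * The worst-case error as a lattice sum *)

Section WorstCaseError.
Context {R : realType}.
Implicit Types (phi : nat -> nat -> R) (Z : nat -> int) (N n d : nat) (c : int).

(** Partial sums of the error series, indexed by any finite list on which the
    coordinate functions v are jointly injective: this form is inherited by the
    slices on which the last coordinate is constant. *)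
Lemma sum_le_lattice_sum (T : eqType) (X : seq T) (v : T -> nat -> int) N n phi Z d c :
  uniq X -> (forall x j, x \in X -> (`|v x j| <= n)%N) ->
  (forall j a, 0 <= phi j a) ->
  {in X &, forall x y, (forall j, (j < d)%N -> v x j = v y j) -> x = y} ->
  \sum_(x <- X) ((N%:Z %| c + \sum_(j < d) v x j * Z j)%Z)%:R *
     (\prod_(j < d) phi j `|v x j|%N) <= lattice_sum N n phi Z d c.
Proof.
move=> uX vn p0; elim: d c X uX vn => [|d IH] c X uX vn inj.
  case: X uX vn inj => [|x [|y X]] uX vn inj.
  - by rewrite big_nil; apply: lattice_sum_ge0.
  - by rewrite big_seq1 !big_ord0 addr0 mulr1.
  - have /= := uX; rewrite inE (inj x y) ?eqxx //; first exact: mem_head.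
    by rewrite !inE eqxx orbT.
pose F x := ((N%:Z %| c + \sum_(j < d.+1) v x j * Z j)%Z)%:R *
     (\prod_(j < d.+1) phi j `|v x j|%N).
have F0 x : 0 <= F x by rewrite mulr_ge0 // prodr_ge0.
have slice e : \sum_(x <- X | v x d == e) F x <=
    phi d `|e|%N * lattice_sum N n phi Z d (c + e * Z d).
  rewrite -big_filter.
  apply: le_trans (ler_wpM2l (p0 d `|e|%N) 
    (IH (c + e * Z d) [seq x <- X | v x d == e] _ _ _)); last first.
  - move=> x y; rewrite !mem_filter => /andP[/eqP xe xX] /andP[/eqP ye yX] h.
    apply: inj => // j; rewrite ltnS leq_eqVlt => /predU1P[->|]; last exact: h.
    by rewrite xe ye.
  - by move=> x j; rewrite mem_filter => /andP[_ /vn].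
  - exact: filter_uniq.
  rewrite mulr_sumr !big_filter; apply: eq_ler.
  apply: eq_bigr => x /eqP xe; rewrite /F !big_ord_recr /= xe.
  by rewrite [_ + e * _]addrC addrA; ring.
apply: (@le_trans _ _ (\sum_(x <- X) ((v x d == 0)%:R +
   \sum_(a < n) ((v x d == a.+1%:Z)%:R + (v x d == - a.+1%:Z)%:R)) * F x)).
  rewrite big_seq [leRHS]big_seq; apply: ler_sum => x xX.
  rewrite -/(F x) ler_peMl //.
  have S0 : 0 <= \sum_(a < n) ((v x d == a.+1%:Z)%:R + (v x d == - a.+1%:Z)%:R) :> R.
    by rewrite sumr_ge0 // => a _; rewrite addr_ge0.
  have := vn x d xX; case: (v x d) S0 => [[|a]|a] S0 an.
  - by rewrite eqxx lerDl.
  - rewrite (bigD1 (Ordinal an)) //= eqxx -[leLHS]add0r lerD //.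
    by rewrite -addrA lerDl addr_ge0 // sumr_ge0 // => b _; rewrite addr_ge0.
  - rewrite (bigD1 (Ordinal an)) //= NegzE eqxx -[leLHS]add0r lerD // addrAC lerDr.
    by rewrite addr_ge0 // sumr_ge0 // => b _; rewrite addr_ge0.
under eq_bigr => x _ do rewrite mulrDl mulr_suml.
rewrite big_split exchange_big /=; apply: lerD.
  have := slice 0; rewrite mul0r addr0 absz0; apply: le_trans.
  rewrite [leRHS]big_mkcond; apply: ler_sum => x _.
  by case: ifP => _; rewrite ?mul1r ?mul0r.
apply: ler_sum => a _; rewrite mulrDr.
under eq_bigr => x _ do rewrite mulrDl.
rewrite big_split; apply: lerD.
  have := slice a.+1%:Z; apply: le_trans.
  rewrite [leRHS]big_mkcond; apply: ler_sum => x _.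
  by case: ifP => _; rewrite ?mul1r ?mul0r.
have := slice (- a.+1%:Z); rewrite abszN mulNr; apply: le_trans.
rewrite [leRHS]big_mkcond; apply: ler_sum => x _.
by case: ifP => _; rewrite ?mul1r ?mul0r.
Qed.

Definition decay_weight (alpha : R) (g : nat -> R) (j a : nat) : R :=
  if a == 0%N then 1 else g j / a%:R `^ alpha.

Lemma inv_decay alpha (g : nat -> R) d (l : 'rV[int]_d) :
  (decay alpha g l)^-1 = \prod_(j < d) decay_weight alpha g j `|(l 0 j)%R|%N.
Proof.
rewrite /decay big_mkcond -prodfV; apply: eq_bigr => j _.
rewrite /decay_weight absz_eq0; case: eqP => _ /=; first by rewrite invr1.
by rewrite invfM invrK -intr_norm -natr_absz.
Qed.

(** The entries of l continued by 0, so that the dimension can vary in an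
    induction. *)
Definition entry d (l : 'rV[int]_d) (j : nat) : int :=
  oapp (fun i : 'I_d => l 0 i) 0 (insub j).

Lemma entryE d (l : 'rV[int]_d) (i : 'I_d) : entry l i = l 0 i.
Proof. by rewrite /entry valK. Qed.

Lemma wce_le N d alpha (g : nat -> R) (z : 'rV[int]_d) (B : R) :
  (forall j, 0 <= g j) ->
  (forall n, lattice_sum_nz N n (decay_weight alpha g) (entry z) d 0 <= B) ->
  (wce N alpha g z <= B%:E)%E.
Proof.
move=> g0 hB; apply: ge_ereal_sup => _ [X [finX XA] <-].
rewrite fsbig_finite //= sumEFin lee_fin.
set s : seq 'rV[int]_d := finmap.enum_fset (fset_set X).
have w0 j a : 0 <= decay_weight alpha g j a.
  by rewrite /decay_weight; case: ifP => // _; rewrite divr_ge0 // powR_ge0.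
have s0 : 0 \notin s.
  by apply/negP; rewrite in_fset_set // inE => /XA /= /eqP.
(* 0 is added to s because the full lattice sum counts it. *)
pose n := (\max_(l <- s) \max_(j < d) `|(l 0 j)%R|)%N.
have ln l (j : nat) : l \in 0 :: s -> (`|entry l j| <= n)%N.
  rewrite inE /entry; case: insubP => [i _ _|_ _] //=.
  move=> /predU1P[->|ls]; first by rewrite mxE.
  have h1 := leq_bigmax_seq (F := fun l : 'rV[int]_d => \max_(j < d) `|(l 0 j)%R|)%N l ls isT.
  have h2 := leq_bigmax (F := fun j => `|(l 0 j)%R|%N) i.
  exact: leq_trans h2 h1.
have := @sum_le_lattice_sum _ (0 :: s) (@entry d) N n _ (entry z) d 0 _ ln w0 _.
rewrite big_cons => le; apply: le_trans (hB n).
rewrite /lattice_sum_nz dvdz0 [\prod_(j < d) _]big1 // mul1r lerBrDl.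
apply: le_trans (le _ _) => [|/=|x y _ _ xy].
- rewrite lerD //.
    rewrite !big1 ?dvdz0 ?mulr1 // => j _; rewrite entryE mxE ?mul0r //.
  apply: ler_sum => l _.
  rewrite inv_decay add0r.
  have -> : \sum_(j < d) entry l j * entry z j = dotz l z.
    by apply: eq_bigr => j _; rewrite !entryE.
  apply: eq_ler; congr (_ * _).
  by apply: eq_bigr => j _; rewrite entryE.
- by rewrite s0 finmap.fset_uniq.
- apply/matrixP => i j; rewrite !ord1 -!entryE; exact: xy.
Qed.

End WorstCaseError.

(** * Characters and dilations modulo a power of two *)

Section Characters.
Context {R : realType}.
Implicit Types (phi : nat -> nat -> R) (Z : nat -> int) (n s m k : nat) (c x : int).

Lemma sin_periodz (t : R) (z : int) : sin (t + pi *+ 2 * z%:~R) = sin t.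
Proof.
case: z => n; first by rewrite mulr_natr (periodicn (@sinD2pi R)).
rewrite NegzE mulrNz mulrN mulr_natr.
by rewrite -[in RHS](subrK (pi *+ 2 *+ n.+1) t) (periodicn (@sinD2pi R)).
Qed.

Lemma cos_periodz (t : R) (z : int) : cos (t + pi *+ 2 * z%:~R) = cos t.
Proof.
by rewrite -[cos t]sinDpihalf -[cos (_ + _)]sinDpihalf addrAC sin_periodz.
Qed.

Lemma sum_cos_arith (h : R) n :
  2 * sin h * (\sum_(k < n) cos (2 * h * k%:R)) = sin (2 * h * n%:R - h) + sin h.
Proof.
elim: n => [|n IH]; first by rewrite big_ord0 !mulr0 add0r sinN addNr.
rewrite big_ord_recr /= mulrDr IH.
have -> : 2 * h * n.+1%:R - h = 2 * h * n%:R + h by rewrite -natr1; ring.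
by rewrite sinB sinD; ring.
Qed.

(** Real part of the additive character e(k c / N) modulo N = 2^m *)
Definition charc m k c : R := cos (2 * (pi * (c%:~R / 2 ^+ m)) * k%:R).

Lemma charcDB m k c x :
  charc m k (c + x) + charc m k (c - x) = 2 * charc m k c * charc m k x.
Proof.
rewrite /charc rmorphD rmorphB /=.
rewrite [_ * _ in X in X + _](_ : _ = 2 * (pi * (c%:~R / 2 ^+ m)) * k%:R +
  2 * (pi * (x%:~R / 2 ^+ m)) * k%:R); last by ring.
rewrite [_ * _ in X in _ + X](_ : _ = 2 * (pi * (c%:~R / 2 ^+ m)) * k%:R -
  2 * (pi * (x%:~R / 2 ^+ m)) * k%:R); last by ring.
by rewrite cosD cosB; ring.
Qed.

Lemma sin_dyadicz_neq0 m c : ~~ ((2 ^ m)%N%:Z %| c)%Z ->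
  sin (pi * (c%:~R / 2 ^+ m)) != 0 :> R.
Proof.
case: c => n; first exact: sin_dyadic_neq0.
rewrite NegzE rpredN mulrNz mulNr mulrN sinN oppr_eq0.
exact: sin_dyadic_neq0.
Qed.

Lemma sum_charc m c :
  \sum_(k < 2 ^ m) charc m k c = 2 ^+ m * (((2 ^ m)%N%:Z %| c)%Z)%:R.
Proof.
have N0 : 2 ^+ m != 0 :> R by rewrite expf_neq0.
case: (boolP (_ %| _)%Z) => [/dvdzP[q ->]|nd].
  rewrite (eq_bigr (fun=> 1)) => [|k _].
    by rewrite sumr_const card_ord natrX mulr1.
  rewrite /charc.
  have -> : 2 * (pi * ((q * (2 ^ m)%N)%:~R / 2 ^+ m)) * k%:R = 0 + pi *+ 2 * (q * k%:Z)%:~R :> R.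
    rewrite !intrM add0r -!pmulrn natrX mulr2n; field; exact: N0.
  by rewrite cos_periodz cos0.
have s0 := sin_dyadicz_neq0 nd.
rewrite mulr0; have := sum_cos_arith (pi * (c%:~R / 2 ^+ m)) (2 ^ m).
rewrite [2 * _ * _%:R](_ : _ = pi *+ 2 * c%:~R); last first.
  by rewrite natrX mulr2n; field; exact: N0.
rewrite [_ - _]addrC sin_periodz sinN addNr => /eqP.
rewrite !mulf_eq0 (negbTE s0) orbF => /orP[|/eqP //].
by rewrite pnatr_eq0.
Qed.

(** Character sum form of the lattice sum: since the coordinate sums are
    symmetric, the k-th Fourier coefficient is a product of cosine sums. *)
Lemma lattice_sum_charc m n phi Z s c :
  2 ^+ m * lattice_sum (2 ^ m) n phi Z s c =
  \sum_(k < 2 ^ m) charc m k c *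
    \prod_(j < s) (phi j 0%N +
       \sum_(a < n) 2 * phi j a.+1 * charc m k (a.+1%:Z * Z j)).
Proof.
elim: s c => [|s IH] c /=.
  by rewrite -sum_charc; apply: eq_bigr => k _; rewrite big_ord0 mulr1.
rewrite mulrDr mulrCA IH mulr_sumr mulr_sumr.
under [X in _ + X]eq_bigr => a _ do
  rewrite mulrCA mulrDr !IH -big_split mulr_sumr /=.
rewrite exchange_big /= -big_split /=; apply: eq_bigr => k _.
rewrite big_ord_recr /=; set P := \prod_(j < s) _.
rewrite mulrDr mulrDr; congr (_ + _); first by ring.
rewrite !mulr_sumr; apply: eq_bigr => a _.
by rewrite -mulrDl charcDB; ring.
Qed.

End Characters.

Section Tails.
Context {R : realType}.
Implicit Types (phi : nat -> nat -> R) (Z : nat -> int) (n s m k N w z : nat) (c x y q : int).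

(** In this form a sum of values of A can be exchanged with a count of the
    solutions of a congruence. *)
Lemma sum_periodic_pick N (A : int -> R) y : (0 < N)%N ->
  (forall c q, A (c + q * N%:Z) = A c) ->
  \sum_(x < N) ((N%:Z %| y - x%:Z)%Z)%:R * A x%:Z = A y.
Proof.
move=> N0 Aper; have N0' : N%:Z != 0 by rewrite lt0r_neq0.
have [i yi] : exists i : 'I_N, y = (y %/ N%:Z)%Z * N%:Z + i%:Z.
  have lt : (`|(y %% N%:Z)%Z| < N)%N.
    by rewrite -ltz_nat gez0_abs ?modz_ge0 // ltz_pmod.
  by exists (Ordinal lt); rewrite /= gez0_abs ?modz_ge0 // -divz_eq.
rewrite (bigD1 i) //= big1 ?addr0 => [|j ji].
  by rewrite {1}yi addrK dvdz_mull // mul1r [in RHS]yi addrC Aper.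
rewrite {1}yi -addrA rpredDl ?dvdz_mull // dvdzE /=.
case: (boolP (_ %| _)%N) => [/dvdn_leq h|_]; last by rewrite mul0r.
have ij : (i : nat) <> j by move=> /ord_inj e; rewrite e eqxx in ji.
have iN := ltn_ord i; have jN := ltn_ord j.
have h2 : (N <= `|(i : nat)%:Z - (j : nat)%:Z|)%N.
  by apply: h; lia.
by exfalso; lia.
Qed.

Lemma sum_dvd_shift N y : (0 < N)%N ->
  \sum_(x < N) ((N%:Z %| y + x%:Z)%Z)%:R = 1 :> R.
Proof.
move=> N0; apply: etrans (@sum_periodic_pick N (fun=> 1) (- y) N0 _) => //.
by apply: eq_bigr => x _; rewrite mulr1 -opprD rpredN.
Qed.

Definition coord_mass n phi j : R := phi j 0%N + \sum_(a < n) 2 * phi j a.+1.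

(** Summing over all residues removes the congruence. *)
Lemma sum_lattice_sum N n phi Z s c : (0 < N)%N ->
  \sum_(x < N) lattice_sum N n phi Z s (c + x%:Z) =
  \prod_(j < s) coord_mass n phi j.
Proof.
move=> N0; elim: s c => [|s IH] c /=; first by rewrite sum_dvd_shift ?big_ord0.
rewrite big_split /= -mulr_sumr IH exchange_big big_ord_recr /=.
rewrite [RHS]mulrC /coord_mass mulrDl; congr (_ + _); rewrite mulr_suml.
apply: eq_bigr => a _; rewrite -mulr_sumr big_split /=.
have e y : \sum_(x < N) lattice_sum N n phi Z s (c + x%:Z + y) = \prod_(j < s) coord_mass n phi j.
  by rewrite -(IH (c + y)); apply: eq_bigr => x _; rewrite addrAC.
by rewrite !e; ring.
Qed.

(** All solutions r agree modulo 2^(m-w), so r is determined by its quotient by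
    2^(m-w). *)
Lemma card_dvd_mul_exp2 m w z y : odd z ->
  (\sum_(r < 2 ^ m) ((2 ^ m)%N%:Z %| (y + r%:Z * (2 ^ w * z)%N%:Z)%R)%Z <= 2 ^ w)%N.
Proof.
move=> zo; pose P (r : 'I_(2 ^ m)) :=
  ((2 ^ m)%N%:Z %| (y + r%:Z * (2 ^ w * z)%N%:Z)%R)%Z.
rewrite (eq_bigr (fun r => if P r then 1%N else 0%N)); last first.
  by move=> r _; rewrite -/(P r); case: (P r).
rewrite -big_mkcond /= sum1_card.
have [mw|wm] := leqP m w.
  by apply: leq_trans (max_card _) _; rewrite card_ord leq_exp2l.
have lt (r : 'I_(2 ^ m)) : (r %/ 2 ^ (m - w) < 2 ^ w)%N.
  by rewrite ltn_divLR ?expn_gt0 // -expnD subnKC ?ltn_ord // ltnW.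
rewrite -[leqRHS]card_ord.
apply: (@leq_card_in _ _ (fun r : 'I_(2 ^ m) => Ordinal (lt r))) => r1 r2.
move=> h1 h2 [eq_div]; have {}h1 : P r1 := h1; have {}h2 : P r2 := h2.
have : ((2 ^ m)%N%:Z %| ((r1 : nat)%:Z - (r2 : nat)%:Z) * (2 ^ w * z)%N%:Z)%Z.
  rewrite [X in (_ %| X)%Z](_ : _ = (y + (r1 : nat)%:Z * (2 ^ w * z)%N%:Z) -
    (y + (r2 : nat)%:Z * (2 ^ w * z)%N%:Z)); last by ring.
  exact: rpredB.
have -> : (2 ^ m)%N%:Z = (2 ^ (m - w))%N%:Z * (2 ^ w)%N%:Z.
  by rewrite -PoszM -expnD subnK // ltnW.
rewrite [(2 ^ w * z)%N]mulnC PoszM mulrA dvdz_mul2r; last first.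
  by rewrite eqz_nat expn_eq0.
rewrite Gauss_dvdzl; last by rewrite coprimezE !absz_nat coprimeXl ?coprime2n.
move=> dv; apply/val_inj => /=.
rewrite (divn_eq r1 (2 ^ (m - w))) (divn_eq r2 (2 ^ (m - w))) eq_div.
congr (_ + _)%N; apply/eqP; rewrite -eqz_nat -!modz_nat.
by rewrite eqz_mod_dvd.
Qed.

Lemma sum_dilate_le m w z (A : int -> R) c (sg : bool) : odd z ->
  (forall c, 0 <= A c) -> (forall c q, A (c + q * (2 ^ m)%N%:Z) = A c) ->
  \sum_(r < 2 ^ m) A (c + (-1) ^+ sg * (r%:Z * (2 ^ w * z)%N%:Z)) <=
  2 ^+ w * \sum_(x < 2 ^ m) A x%:Z.
Proof.
move=> zo A0 Aper; have N0 : (0 < 2 ^ m)%N by rewrite expn_gt0.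
under eq_bigr => r _ do rewrite -(sum_periodic_pick _ N0 Aper).
rewrite exchange_big mulr_sumr /=; apply: ler_sum => x _.
rewrite -mulr_suml ler_wpM2r // -natr_sum -natrX ler_nat.
apply: leq_trans (card_dvd_mul_exp2 m w ((-1) ^+ sg * (c - x%:Z)) zo).
apply: leq_sum => r _; apply: eq_leq; congr (nat_of_bool _).
case: sg; rewrite ?expr1 ?expr0 ?mul1r; last by rewrite addrAC.
rewrite -rpredN; congr (_ %| _)%Z; ring.
Qed.

End Tails.

(** * Dual points outside a box *)

Section TailBound.
Context {R : realType}.
Implicit Types (phi : nat -> nat -> R) (n s m k q Q : nat) (c x : int).

Lemma coord_mass_ge1 n phi j : (forall j a, 0 <= phi j a) ->
  (forall j, phi j 0%N = 1) -> 1 <= coord_mass n phi j.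
Proof.
move=> p0 p1; rewrite /coord_mass p1 lerDl sumr_ge0 // => a _.
by rewrite mulr_ge0.
Qed.

(** The frequencies with a coordinate of modulus more than N: a full block of N
    consecutive values of that coordinate meets every residue at most 2^w times,
    so the congruence still saves the factor N / 2^w there, whatever the other
    coordinates are. *)
Lemma lattice_sum_tail m Q phi (beta t : nat -> R) (T : R) (w z : nat -> nat)
    (Z : nat -> int) s c :
  (0 < Q)%N -> (forall j a, 0 <= phi j a) -> (forall j, phi j 0%N = 1) ->
  (forall j, 0 <= beta j) -> (forall q, 0 <= t q) -> (forall j, odd (z j)) ->
  (forall j, Z j = (2 ^ w j * z j)%N%:Z) ->
  (forall j q r, (0 < q)%N -> phi j (q * 2 ^ m + r).+1 <= beta j * t q) ->
  \sum_(1 <= q < Q) t q <= T ->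
  lattice_sum (2 ^ m) (Q * 2 ^ m) phi Z s c <=
  lattice_sum (2 ^ m) (2 ^ m) phi Z s c +
     (\sum_(j < s) 2 * beta j * T * 2 ^+ w j) *
     \prod_(j < s) coord_mass (Q * 2 ^ m) phi j.
Proof.
move=> Q0 p0 p1 b0 t0 zo ZE hphi hT.
have N0 : (0 < 2 ^ m)%N by rewrite expn_gt0.
have T0 : 0 <= T by apply: le_trans hT; rewrite sumr_ge0.
set N := (2 ^ m)%N in N0 hphi *; set M := (Q * N)%N.
elim: s c => [|s IH] c; first by rewrite !big_ord0 mul0r addr0.
rewrite [lattice_sum N M _ _ _ _]/=; rewrite [lattice_sum N N _ _ s.+1 _]/=.
set U := \prod_(j < s) coord_mass M phi j in IH.
set V := \sum_(j < s) _ in IH.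
have U1 : 1 <= U.
  rewrite /U; elim/big_ind: _ => // [x y x1 y1|j _]; first exact: mulr_ege1.
  exact: coord_mass_ge1.
have V0 : 0 <= V by rewrite sumr_ge0 // => j _; rewrite !mulr_ge0 ?exprn_ge0.
set A := lattice_sum N M phi Z s in IH *; set B := lattice_sum N N phi Z s in IH *.
have A0 y : 0 <= A y by apply: lattice_sum_ge0.
have Aper (y q : int) : A (y + q * N%:Z) = A y by apply: lattice_sum_period.
have Asum : \sum_(x < N) A x%:Z = U.
  rewrite /U -(sum_lattice_sum M phi Z s 0 N0).
  by apply: eq_bigr => x _; rewrite add0r.
have block (sg : bool) q : \sum_(r < N) A (c + (-1) ^+ sg * ((q * N + r).+1%:Z * Z s)) <= 2 ^+ w s * U.
  rewrite -Asum.
  have := sum_dilate_le (w s) (c + (-1) ^+ sg * ((q * N).+1%:Z * Z s)) sg (zo s) A0 Aper; rewrite -ZE.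
  apply: le_trans; apply: eq_ler; apply: eq_bigr => r _; congr (A _).
  rewrite -addrA; congr (_ + _); rewrite -addSn PoszD; ring.
rewrite !p1 !mul1r.
pose F a := phi s a.+1 * (A (c + a.+1%:Z * Z s) + A (c - a.+1%:Z * Z s)).
rewrite -[\sum_(a < M) _](big_mkord xpredT F) /M big_nat_mul big_ltn //.
rewrite mul0n mul1n.
have tail : \sum_(1 <= q < Q) \sum_(q * N <= a < q.+1 * N) F a <=
    2 * beta s * T * 2 ^+ w s * U.
  apply: (@le_trans _ _ (\sum_(1 <= q < Q) (2 * beta s * 2 ^+ w s * U) * t q)); last first.
    rewrite -mulr_sumr; have -> : 2 * beta s * T * 2 ^+ w s * U =
      2 * beta s * 2 ^+ w s * U * T by ring.
    by rewrite ler_wpM2l // !mulr_ge0 ?exprn_ge0 //; lra.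
  rewrite big_nat_cond [leRHS]big_nat_cond; apply: ler_sum => q /andP[/andP[q1 _] _].
  rewrite -{1}[(q * N)%N]add0n big_addn mulSn addnK big_mkord.
  apply: (@le_trans _ _ (\sum_(r < N) beta s * t q *
     (A (c + (-1) ^+ false * ((q * N + r).+1%:Z * Z s)) +
      A (c + (-1) ^+ true * ((q * N + r).+1%:Z * Z s))))).
    apply: ler_sum => r _; rewrite /F addnC expr0 expr1 mul1r mulN1r.
    by rewrite ler_wpM2r ?addr_ge0 // hphi.
  rewrite -mulr_sumr big_split /=.
  have := block false q; have := block true q; rewrite expr0 expr1.
  have : 0 <= beta s * t q by rewrite mulr_ge0.
  set b := beta s * t q => b0' h1 h2.
  have := lerD h2 h1 => /(ler_wpM2l b0').
  by rewrite /b => h; apply: (le_trans h); apply: eq_ler; ring.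
have head : \sum_(0 <= a < N) F a <= \sum_(a < N) phi s a.+1 *
     (B (c + a.+1%:Z * Z s) + B (c - a.+1%:Z * Z s)) +
     (\sum_(a < N) 2 * phi s a.+1) * (V * U).
  rewrite big_mkord mulr_suml -big_split /=; apply: ler_sum => a _.
  rewrite /F; have := IH (c + a.+1%:Z * Z s); have := IH (c - a.+1%:Z * Z s).
  move=> h1 h2; have := lerD h2 h1 => /(ler_wpM2l (p0 s a.+1)).
  by move=> h; apply: (le_trans h); apply: eq_ler; ring.
rewrite !big_ord_recr /= -/U -/V; set W := coord_mass M phi s.
have W1 : 1 <= W by apply: coord_mass_ge1.
have WN : 1 + \sum_(a < N) 2 * phi s a.+1 <= W.
  rewrite /W /coord_mass p1 lerD2l.
  pose f a := 2 * phi s a.+1.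
  apply: (ler_sum_ord_widen (F := f) (G := f)) => // [|a].
    by rewrite leq_pmull.
  by rewrite mulr_ge0.
have E0 : 0 <= 2 * beta s * T * 2 ^+ w s * U by rewrite !mulr_ge0 ?exprn_ge0 //; lra.
have := IH c; move: head tail WN; rewrite -/A -/B.
set X := \sum_(0 <= a < N) _; set Y := \sum_(1 <= q < Q) _.
set P := \sum_(a < N) 2 * _; set D := \sum_(a < N) _ * _.
set E := 2 * beta s * T * 2 ^+ w s in E0 *.
move=> h1 h2 h3 h4.
have h5 : (1 + P) * (V * U) <= W * (V * U) by rewrite ler_wpM2r // mulr_ge0 //; lra.
have h6 : E * U <= E * U * W by rewrite ler_peMr.
have -> : (V + E) * (U * W) = W * (V * U) + E * U * W by ring.
lra.
Qed.

End TailBound.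

(** * The damped logarithmic series *)

Section LogKernel.
Context {R : realType}.
Implicit Types (r rho theta eps : R) (n : nat).

(** Partial sum of - log |1 - r e^(i theta)|^2 = Sum_(a >= 1) 2 r^a cos(a theta) / a. *)
Definition log_series n r theta : R :=
  \sum_(a < n) 2 * r ^+ a.+1 * cos (a.+1%:R * theta) / a.+1%:R.

(** |1 - r e^(i theta)|^2 *)
Definition sqdist r theta : R := 1 - 2 * r * cos theta + r ^+ 2.

Lemma sqdist_ge r theta : 0 <= r -> (1 - r) ^+ 2 <= sqdist r theta.
Proof.
move=> r0; rewrite /sqdist; have := cos_le1 theta; nra.
Qed.

Lemma sqdist_le r theta : 0 <= r <= 1 -> sqdist r theta <= 4.
Proof.
move=> /andP[r0 r1]; rewrite /sqdist; have := cos_geN1 theta; nra.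
Qed.

Lemma sqdist_gt0 r theta : 0 <= r < 1 -> 0 < sqdist r theta.
Proof.
move=> /andP[r0 r1]; apply: lt_le_trans (sqdist_ge theta r0).
by rewrite exprn_even_gt0 //= subr_eq0 gt_eqF.
Qed.

Lemma sqdist_sin r theta :
  sqdist r (theta *+ 2) = (1 - r) ^+ 2 + 4 * r * sin theta ^+ 2.
Proof.
rewrite /sqdist cos_mulr2n cos2sin2 mulr2n; ring.
Qed.

Lemma sum_pow_cos n r theta :
  sqdist r theta * (\sum_(a < n) r ^+ a * cos (a.+1%:R * theta)) =
  cos theta - r - r ^+ n * cos (n.+1%:R * theta) + r ^+ n.+1 * cos (n%:R * theta).
Proof.
elim: n => [|n IH]; first by rewrite big_ord0 mulr0 mulr0n mulr1n mul0r cos0 expr0 expr1 !mul1r mulr1; ring.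
rewrite big_ord_recr /= mulrDr {}IH.
have -> : cos (n.+2%:R * theta) = 2 * cos theta * cos (n.+1%:R * theta) - cos (n%:R * theta).
  have -> : n.+2%:R * theta = n.+1%:R * theta + theta by rewrite -[n.+2%:R]natr1 mulrDl mul1r.
  have -> : n%:R * theta = n.+1%:R * theta - theta by rewrite -[n.+1%:R]natr1 mulrDl mul1r addrK.
  by rewrite cosB cosD; lra.
by rewrite /sqdist !exprS; ring.
Qed.

Lemma is_derive_log_series n r theta :
  is_derive r 1 (fun r => log_series n r theta)
    (2 * \sum_(a < n) r ^+ a * cos (a.+1%:R * theta)).
Proof.
pose p : {poly R} :=
  \sum_(a < n) (2 * cos (a.+1%:R * theta) / a.+1%:R) *: 'X^(a.+1).
have -> : (fun r => log_series n r theta) = horner p.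
  apply/funext => x; rewrite /log_series horner_sum; apply: eq_bigr => a _.
  by rewrite hornerZ hornerXn; ring.
have <- : (deriv p).[r] = 2 * \sum_(a < n) r ^+ a * cos (a.+1%:R * theta).
  rewrite linear_sum horner_sum mulr_sumr; apply: eq_bigr => a _.
  rewrite /= derivZ derivXn hornerZ hornerMn hornerXn -mulr_natl /=.
  by field; rewrite nat1r pnatr_eq0.
exact: is_derive_poly.
Qed.

Lemma is_derive_ln_sqdist r theta : 0 <= r < 1 ->
  is_derive r 1 (fun r => ln (sqdist r theta))
    ((2 * r - 2 * cos theta) / sqdist r theta).
Proof.
move=> r01; pose p : {poly R} := 1 - (2 * cos theta) *: 'X + 'X^2.
have pE x : p.[x] = sqdist x theta.
  by rewrite /p /sqdist !hornerE; ring.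
have dE : (deriv p).[r] = 2 * r - 2 * cos theta.
  by rewrite /p !poly.derivE !hornerE /=; ring.
have dp := is_derive_poly p r.
have dl : is_derive p.[r] 1 (@ln R) p.[r]^-1.
  by apply: is_derive1_ln; rewrite pE sqdist_gt0.
have -> : (fun r => ln (sqdist r theta)) = @ln R \o horner p.
  by apply/funext => x /=; rewrite pE.
by rewrite -pE -dE mulrC; exact: is_derive1_comp.
Qed.

(** The two terms vanish at r = 0 and have opposite derivatives in r, up to the
    geometric remainder of the differentiated series. *)
Lemma log_series_near n rho theta : 0 <= rho < 1 ->
  `|ln (sqdist rho theta) + log_series n rho theta| <=
  4 * rho ^+ n / (1 - rho) ^+ 2.
Proof.
move=> /andP[r0 r1].
pose f r := ln (sqdist r theta) + log_series n r theta.
pose df r := (2 * r - 2 * cos theta) / sqdist r theta +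
   2 * \sum_(a < n) r ^+ a * cos (a.+1%:R * theta).
have fd r : 0 <= r < 1 -> is_derive r 1 f (df r).
  move=> r01; have h1 := is_derive_ln_sqdist theta r01.
  have h2 := is_derive_log_series n r theta.
  exact: is_deriveD.
have f0 : f 0 = 0.
  rewrite /f /sqdist mulr0 mul0r subr0 expr0n addr0 ln1 add0r.
  by rewrite /log_series big1 // => a _; rewrite expr0n mulr0 !mul0r.
have [c] : exists2 c, c \in `[0, rho] & f rho - f 0 = df c * (rho - 0).
  apply: MVT_segment => //.
    by move=> x; rewrite in_itv /= => /andP[x0 xr]; apply: fd; lra.
  apply: derivable_within_continuous => x; rewrite in_itv /= => /andP[x0 xr].
  by apply: (@ex_derive _ _ _ _ _ _ _ (fd x _)); lra.
rewrite in_itv /= => /andP[c0 cr]; rewrite f0 !subr0 -/(f rho) => ->.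
have D0 : 0 < sqdist c theta by rewrite sqdist_gt0 //; lra.
have -> : df c = 2 * (c ^+ n.+1 * cos (n%:R * theta) -
    c ^+ n * cos (n.+1%:R * theta)) / sqdist c theta.
  rewrite /df; have := sum_pow_cos n c theta; set s := \sum_(a < _) _ => h.
  have -> : s = (sqdist c theta * s) / sqdist c theta by rewrite mulrC mulKf // gt_eqF.
  by rewrite h; field; rewrite gt_eqF.
have cn0 : 0 <= c ^+ n by rewrite exprn_ge0.
have rn0 : 0 <= rho ^+ n by rewrite exprn_ge0.
have cn : c ^+ n <= rho ^+ n by rewrite lerXn2r // nnegrE.
have num : `|c ^+ n.+1 * cos (n%:R * theta) - c ^+ n * cos (n.+1%:R * theta)|
    <= 2 * rho ^+ n.
  apply: (le_trans (ler_normB _ _)); rewrite !normrM exprS normrM.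
  rewrite (ger0_norm c0) (ger0_norm cn0).
  have := cos_max (n%:R * theta); have := cos_max (n.+1%:R * theta).
  have := normr_ge0 (cos (n%:R * theta)); have := normr_ge0 (cos (n.+1%:R * theta)).
  set u := `|_|; set v := `|_| => u0 v0 u1 v1.
  have : c ^+ n * u <= c ^+ n by rewrite ler_piMr.
  have : c * c ^+ n * v <= c ^+ n.
    by rewrite mulrAC ler_piMl // mulr_ile1 //; lra.
  lra.
have den : (1 - rho) ^+ 2 <= sqdist c theta.
  apply: le_trans (sqdist_ge theta c0); rewrite lerXn2r ?nnegrE; lra.
have p0 : 0 < (1 - rho) ^+ 2 by rewrite exprn_even_gt0 //= subr_eq0 gt_eqF.
rewrite !normrM normfV (gtr0_norm D0) (ger0_norm r0) (ger0_norm (_ : 0 <= 2)) //.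
rewrite -[leRHS]mulr1 ler_pM //; last lra.
  by rewrite !mulr_ge0 ?invr_ge0 ?(ltW D0).
rewrite ler_pM //.
- by rewrite invr_ge0 ltW.
- move: num; set u := `|_|; lra.
- by rewrite lef_pV2.
Qed.

Lemma log_series_trunc rho eps : 0 <= rho < 1 -> 0 < eps ->
  exists n0, forall n theta, (n0 <= n)%N ->
  `|ln (sqdist rho theta) + log_series n rho theta| <= eps.
Proof.
move=> r01 e0; have /andP[r0 r1] := r01.
have rn : `|rho| < 1 by rewrite ger0_norm.
have := cvg_geometric (4 / (1 - rho) ^+ 2) rn.
move/cvgrPdist_le => /(_ _ e0) [n0 _ h].
exists n0 => n theta n0n; apply: (le_trans (log_series_near n theta r01)).
have := h n n0n; rewrite /= sub0r normrN ger0_norm; first lra.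
by rewrite mulr_ge0 ?exprn_ge0 // divr_ge0 // sqr_ge0.
Qed.

End LogKernel.

(** * A cosine polynomial just above the logarithm *)

Section DampedKernel.
Context {R : realType}.
Local Notation L := (@log_inv_sin2 R).
Implicit Types (rho eps x : R) (m n k a Y : nat).

Lemma ln4_le2 : ln 4 <= 2 :> R.
Proof.
have -> : 4 = (1 + 1) ^+ 2 :> R by rewrite expr2; ring.
rewrite lnXn; last by lra.
by rewrite -mulr_natl; have := @le_ln1Dx R 1; lra.
Qed.

Lemma ln4_ge0 : 0 <= ln 4 :> R.
Proof. by rewrite ln_ge0 //; lra. Qed.

Lemma bernoulli_le x n : 0 <= x <= 1 -> 1 - n%:R * x <= (1 - x) ^+ n.
Proof.
move=> /andP[x0 x1]; elim: n => [|n IH]; first by rewrite expr0 mul0r subr0.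
rewrite exprS -natr1.
have h : (1 - x) * (1 - n%:R * x) <= (1 - x) * (1 - x) ^+ n by rewrite ler_wpM2l //; lra.
apply: le_trans h; have : 0 <= n%:R * (x * x) by rewrite !mulr_ge0.
by lra.
Qed.

(** Because |1 - rho e^(2 i theta)|^2 is at least 4 rho sin^2 theta. *)
Lemma ln4_sub_ln_sqdist_le rho x : 0 < rho < 1 -> sin (pi * x) != 0 ->
  ln 4 - ln (sqdist rho ((pi * x) *+ 2)) <= L x + (rho^-1 - 1).
Proof.
move=> /andP[r0 r1] s0.
have p0 : 0 < sin (pi * x) ^+ 2 by rewrite exprn_even_gt0.
have q0 : (0 : R) < 4 by [].
have r4 : 0 < 4 * rho by rewrite mulr_gt0.
have D0 : 0 < sqdist rho (pi * x *+ 2) by rewrite sqdist_gt0 // ltW.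
have h : ln (4 * rho * sin (pi * x) ^+ 2) <= ln (sqdist rho ((pi * x) *+ 2)).
  rewrite ler_ln ?posrE ?(mulr_gt0 r4) //.
  by rewrite sqdist_sin lerDr sqr_ge0.
rewrite lnM ?posrE // lnM ?posrE // in h.
have : ln rho^-1 <= rho^-1 - 1.
  have := @le_ln1Dx R (rho^-1 - 1); have -> : 1 + (rho^-1 - 1) = rho^-1 by ring.
  by apply; rewrite ltrBrDl subrr invr_gt0.
rewrite lnV ?posrE // log_inv_sin2E; lra.
Qed.

(** With N = 2^m and rho = 1 - N^-2, the series damped by rho^a and truncated
    far out exceeds - ln sin^2 - ln 4 by O(1 / N) only, while it stays O(m)
    everywhere.  Rescaling it by rho^-N lifts the coefficients up to frequency N
    above the 1 / a of the logarithm, at the price of a relative error O(1 / N);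
    adding the truncation error to the constant term keeps it nonnegative. *)
Lemma damped_log_kernel m : (0 < m)%N ->
  exists n (kap : nat -> R),
  [/\ (2 ^ m <= n)%N, forall a, 0 <= kap a, ln 4 <= kap 0%N,
      forall a, (0 < a <= 2 ^ m)%N -> a%:R^-1 <= kap a &
      forall Y k, let G := kap 0%N + \sum_(a < n) 2 * kap a.+1 * charc m k (a.+1%:Z * Y%:Z) in
       [/\ 0 <= G, G <= 14 * m%:R &
         ~~ (2 ^ m %| Y * k)%N -> G <= L ((Y * k)%N%:R / 2 ^+ m) + 17 * m%:R / 2 ^+ m]].
Proof.
move=> m0; pose N : R := 2 ^+ m; pose x : R := (N ^+ 2)^-1; pose rho := 1 - x.
have N2 : 2 <= N by rewrite /N -[leLHS]expr1 ler_eXn2l //; lra.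
have x0 : 0 < x by rewrite invr_gt0 exprn_gt0 //; lra.
have xN : x * N = N^-1 by rewrite /x; field; lra.
have iN : 0 < N^-1 <= 1 / 2.
  by rewrite invr_gt0 -[1 / 2]invrK lef_pV2 ?posrE //; lra.
have xi : x <= N^-1 / 2 by rewrite /x expr2 invfM; nra.
have r01 : 0 < rho < 1 by rewrite /rho; lra.
have r01' : 0 <= rho < 1 by lra.
have [n0 hn0] := @log_series_trunc R rho N^-1 r01' (proj1 (andP iN)).
pose n := maxn n0 (2 ^ m)%N.
pose q := (rho ^+ (2 ^ m))^-1.
have rN : 1 - N^-1 <= rho ^+ (2 ^ m).
  have := @bernoulli_le x (2 ^ m)%N; rewrite natrX -/N mulrC xN; apply; lra.
have rN0 : 0 < rho ^+ (2 ^ m) by rewrite exprn_gt0 //; lra.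
have rN1 : rho ^+ (2 ^ m) <= 1 by rewrite exprn_ile1 //; lra.
have q1 : 1 <= q by rewrite /q invf_ge1.
have qN : q - 1 <= 2 * N^-1.
  have : q * rho ^+ (2 ^ m) = 1 by rewrite /q mulVf // gt_eqF.
  have : q * (1 - N^-1) <= q * rho ^+ (2 ^ m) by rewrite ler_wpM2l //; lra.
  nra.
pose kap a := if a is a'.+1 then q * rho ^+ a / a%:R else q * (ln 4 + N^-1).
have q0 : 0 <= q by lra.
have l4 := ln4_ge0; have l42 := ln4_le2.
exists n, kap; split.
- exact: leq_maxr.
- move=> [|a] /=; first by rewrite mulr_ge0 // addr_ge0 //; lra.
  by rewrite !mulr_ge0 ?invr_ge0 ?exprn_ge0 //; lra.
- rewrite /= -[leLHS]mul1r ler_pM //; lra.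
- case=> [//|a] /andP[_ aN] /=.
  rewrite -[leLHS]mul1r ler_wpM2r ?invr_ge0 //.
  have : q * rho ^+ (2 ^ m) <= q * rho ^+ a.+1.
    by rewrite ler_wpM2l // ler_wiXn2l //; lra.
  by rewrite /q mulVf // gt_eqF.
move=> Y k; set phi := (pi * ((Y * k)%N%:R / N)) *+ 2.
have -> : kap 0%N + \sum_(a < n) 2 * kap a.+1 * charc m k (a.+1%:Z * Y%:Z) =
    q * (ln 4 + log_series n rho phi + N^-1).
  rewrite addrAC [RHS]mulrDr; congr (_ + _); rewrite mulr_sumr; apply: eq_bigr => a _ /=.
  have -> : charc m k (a.+1%:Z * Y%:Z) = cos (a.+1%:R * phi).
    rewrite /charc /phi; congr cos; rewrite intrM -!pmulrn natrM mulr2n; ring.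
  ring.
set H := _ + N^-1.
have := hn0 n phi (leq_maxl _ _); rewrite ler_norml => /andP[F1 F2].
have D0 := sqdist_gt0 phi r01'.
have H0 : 0 <= H.
  have : ln (sqdist rho phi) <= ln 4 by rewrite ler_ln ?posrE // sqdist_le //; lra.
  rewrite /H; lra.
have m1 : 1 <= m%:R :> R by rewrite ler1n.
(* ln 4 + 2 m ln 4 + 2 / N with ln 4 <= 2 and 2 / N <= 1 *)
have H7 : H <= 7 * m%:R.
  have : ln ((1 - rho) ^+ 2) <= ln (sqdist rho phi).
    have p0 : 0 < (1 - rho) ^+ 2 by rewrite exprn_gt0 //; lra.
    by rewrite ler_ln ?posrE // sqdist_ge //; lra.
  have -> : (1 - rho) ^+ 2 = (4 ^+ (m * 2))^-1.
    have -> : 1 - rho = x by rewrite /rho; ring.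
    have NE : N ^+ 2 = 4 ^+ m.
      by rewrite /N -exprM mulnC exprM; congr (_ ^+ _); ring.
    by rewrite /x NE exprVn exprM.
  have -> : ln (4 ^+ (m * 2))^-1 = - (m%:R * 2 * ln 4) :> R.
    by rewrite lnV ?posrE ?exprn_gt0 // lnXn // -[_ *+ _]mulr_natl natrM.
  have : m%:R * ln 4 <= m%:R * 2 :> R by rewrite ler_wpM2l.
  rewrite /H; lra.
have Hq : q * H <= H + 14 * m%:R * N^-1.
  have : (q - 1) * H <= 2 * N^-1 * (7 * m%:R) by rewrite ler_pM //; lra.
  lra.
split.
- by rewrite mulr_ge0.
- have : q * H <= 2 * (7 * m%:R) by rewrite ler_pM //; lra.
  lra.
move=> nd; apply: (le_trans Hq).
have := ln4_sub_ln_sqdist_le r01 (sin_dyadic_neq0 nd); rewrite -/N -/phi.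
have : rho^-1 - 1 <= N^-1.
  have : rho * rho^-1 = 1 by rewrite mulfV // gt_eqF //; lra.
  have : 0 < rho^-1 by rewrite invr_gt0; lra.
  rewrite /rho; nra.
have : N^-1 <= m%:R * N^-1 by rewrite ler_peMl //; lra.
rewrite /H; lra.
Qed.

End DampedKernel.

(** * The quality function and its telescoping *)

Section DigitByDigit.
Context {R : realType}.
Local Notation L := (@log_inv_sin2 R).
Implicit Types (g : nat -> R) (w z : nat -> nat) (m s v t k x n T : nat).

(** Expansion of a product over the subsets of [s], each given as the trace of
    a subset of [s+1] containing the last element. *)
Lemma sum_set_max s g (f : nat -> R) :
  \sum_(u : {set 'I_s.+1} | ord_max \in u)
     prod_weight g (u :\ ord_max) * (\prod_(j in u :\ ord_max) f j) =
  \prod_(j < s) (1 + g j * f j).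
Proof.
pose F (i : 'I_s.+1) := if i == ord_max then 1 else g i * f i.
pose G (i : 'I_s.+1) : R := (i != ord_max)%:R.
have -> : \prod_(j < s) (1 + g j * f j) = \prod_i (F i + G i).
  rewrite big_ord_recr /= /F /G eqxx addr0 mulr1; apply: eq_bigr => i _.
  have /negbTE -> : widen_ord (leqnSn s) i != ord_max.
    by rewrite -val_eqE /= ltn_eqF.
  by rewrite addrC.
rewrite bigA_distr; rewrite [RHS](bigID (fun u : {set _} => ord_max \in u)) /=.
rewrite [X in _ = _ + X]big1 ?addr0 => [|u /negbTE mu]; last first.
  by rewrite (bigD1 ord_max) //= mu /G eqxx mul0r.
apply: eq_big => [u|u mu]; first by rewrite ?inE.
rewrite /prod_weight -big_split /= [LHS]big_mkcond /=; apply: eq_bigr => i _.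
rewrite !inE /F /G; case: eqP => [->|_] /=; first by rewrite mu.
by case: ifP.
Qed.

Lemma sum_odd_blocks (f : nat -> R) t n : (0 < t)%N ->
  \sum_(0 <= l < n) \sum_(l * 2 ^ t + 1 <= k < l.+1 * 2 ^ t | odd k) f k =
  \sum_(0 <= k < n * 2 ^ t | odd k) f k.
Proof.
move=> t0; rewrite [RHS]big_mkcond big_nat_mul; apply: eq_bigr => l _.
rewrite -[RHS]big_mkcond.
rewrite [RHS]big_ltn_cond; last by rewrite ltn_pmul2r ?expn_gt0.
by rewrite oddM oddX eqn0Ngt t0 andbF addn1.
Qed.

Definition log_product g w z s T k : R :=
  \prod_(j < s) (1 + g j * L ((2 ^ w j * z j * k)%N%:R / 2 ^+ T)).

(** The pairs (l, k) of the definition enumerate the odd k below 2^(t + w_s), and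
    the sum over the sets u is a product because the weights are. *)
Lemma quality_log_product g w m z s v x : (0 < v)%N -> (w s <= m)%N ->
  (forall j, (j < s)%N -> (w j <= w s)%N) ->
  quality g w m z s v x =
  \sum_(v <= t < (m - w s).+1) 1 / 2 ^+ (t - v) *
    \sum_(0 <= k < 2 ^ (t + w s) | odd k)
      log_product g w z s (t + w s) k * (1 + g s * L ((k * x)%N%:R / 2 ^+ v)).
Proof.
move=> v0 wm wj; apply: eq_big_nat => t /andP[vt _]; congr (_ * _).
have t0 : (0 < t)%N by apply: leq_trans vt.
rewrite addnC expnD -sum_odd_blocks //; apply: eq_bigr => l _; apply: eq_bigr => k ko.
rewrite -mulr_suml -natrM; congr (_ * _).
rewrite (sum_set_max _ g (fun j => L ((z j)%:R * (k%:R / 2 ^+ t) * (2 ^+ (m - w s) / 2 ^+ (m - w j))))).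
apply: eq_bigr => j _; congr (1 + _ * L _).
have js := wj j (ltn_ord j).
have -> : (m - w j = (m - w s) + (w s - w j))%N by lia.
have -> : (w s + t = t + (w s - w j) + w j)%N by lia.
rewrite !exprD !natrM natrX; field.
by rewrite !expf_neq0.
Qed.

Lemma log_inv_sin2_digit_average k x v : odd k -> odd x -> (1 < v)%N ->
  L ((k * x)%N%:R / 2 ^+ v) + L ((k * (x + 2 ^ v.-1))%N%:R / 2 ^+ v) =
  ln 4 + L ((k * x)%N%:R / 2 ^+ v.-1).
Proof.
case: v => [//|v] ko xo v0; rewrite /=.
have p0 : 2 ^+ v != 0 :> R by rewrite expf_neq0.
have e1 : (k * x)%N%:R / 2 ^+ v = 2 * ((k * x)%N%:R / 2 ^+ v.+1) :> R.
  by rewrite exprS; field.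
have -> : (k * (x + 2 ^ v))%N%:R / 2 ^+ v.+1 =
    (k * x)%N%:R / 2 ^+ v.+1 + 1 / 2 + k./2%:R :> R.
  rewrite mulnDr natrD [(k * 2 ^ v)%N%:R]natrM natrX.
  rewrite -{2}[k]odd_double_half ko natrD -mul2n natrM exprS /=; field; exact: p0.
rewrite log_inv_sin2_period e1 log_inv_sin2_double // -e1.
by apply: sin_dyadic_neq0; rewrite odd_ndvd_exp2 // oddM ko.
Qed.

(** The abstract recursion behind the digit-by-digit search: the weights 2^-(t-v)
    are exactly those for which choosing digit v costs half the tail of S. *)
Lemma digit_telescope n (c : R) (S : nat -> R) (a : nat -> nat -> R) :
  0 <= c -> (forall t, 0 <= S t) -> (0 < n)%N ->
  (forall t, a t 1%N = 0) ->
  (forall v, (1 < v <= n)%N ->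
    \sum_(v <= t < n.+1) 1 / 2 ^+ (t - v) * a t v <=
    \sum_(v <= t < n.+1) 1 / 2 ^+ (t - v) * ((c * S t + a t v.-1) / 2)) ->
  \sum_(1 <= v < n.+1) a v v <= c * \sum_(1 <= t < n.+1) S t.
Proof.
move=> c0 S0 n0 a1 hA.
pose H v (f : nat -> R) := \sum_(v <= t < n.+1) 1 / 2 ^+ (t - v) * f t.
have HS v f : (v <= n)%N -> H v f = f v + H v.+1 f / 2.
  move=> vn; rewrite /H big_ltn ?ltnS // subnn expr0 divr1 mul1r; congr (_ + _).
  rewrite mulr_suml; apply: eq_big_nat => t /andP[vt _].
  have -> : (t - v = (t - v.+1).+1)%N by lia.
  by rewrite exprS; field; rewrite expf_neq0.
have Hn f : H n f = f n by rewrite /H big_nat1 subnn expr0 divr1 mul1r.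
(* The tail of S on the right is what the digits still to be chosen may cost. *)
suff key v : (v < n)%N -> \sum_(1 <= u < v.+1) a u u + H v.+1 (a ^~ v.+1) <=
    c * (\sum_(1 <= t < v.+1) S t + H v.+1 S).
  have := key n.-1; rewrite prednK // !Hn => /(_ (leqnn _)).
  by rewrite [\sum_(1 <= v < n.+1) a v v]big_nat_recr // [\sum_(1 <= t < n.+1) S t]big_nat_recr.
elim: v => [_|v IH vn].
  rewrite !big_geq // !add0r [X in X <= _]big1 => [|t _]; last by rewrite a1 mulr0.
  by rewrite mulr_ge0 // sumr_ge0 // => t _; rewrite mulr_ge0 // divr_ge0 ?exprn_ge0.
have {}IH := IH (ltnW vn).
have := hA v.+2; rewrite vn /= => /(_ isT); rewrite -/(H v.+2 (a ^~ v.+2)).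
set X := (X in _ <= X) => h.
have XE : X = (c * H v.+2 S + H v.+2 (a ^~ v.+1)) / 2.
  rewrite /X /H mulr_sumr -big_split mulr_suml; apply: eq_bigr => t _ /=; ring.
move: IH h; rewrite XE (HS v.+1 S (ltnW vn)) (HS v.+1 (a ^~ v.+1) (ltnW vn)).
rewrite [\sum_(1 <= u < v.+2) a u u]big_nat_recr // [\sum_(1 <= u < v.+2) S u]big_nat_recr //=.
lra.
Qed.

End DigitByDigit.

(** * The average over a component found digit by digit *)

Section ReducedSearch.
Context {R : realType}.
Local Notation L := (@log_inv_sin2 R).
Implicit Types (g : nat -> R) (w z : nat -> nat) (m s v t k x n T : nat).

Lemma sum_parity (f : nat -> R) (P : pred nat) n :
  \sum_(0 <= k < n * 2 | P k) f k =
  \sum_(0 <= k < n * 2 | odd k && P k) f k + \sum_(0 <= k < n | P (k * 2)%N) f (k * 2)%N.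
Proof.
rewrite big_mkcond [X in X + _]big_mkcond [X in _ + X]big_mkcond /=.
elim: n => [|n IH]; first by rewrite !big_geq // addr0.
rewrite mulSn addnC addn2 !big_nat_recr //= IH oddM andbF /=; ring.
Qed.

(** Sorting the k not divisible by 2^n by their power of two: k / 2^(n+u) in
    lowest terms is an odd multiple of 1 / 2^(v+u) with 1 <= v <= n. *)
Lemma sum_dyadic_levels (f : nat -> R) u n :
  \sum_(0 <= k < 2 ^ (n + u) | ~~ (2 ^ n %| k)%N) f k =
  \sum_(1 <= v < n.+1) \sum_(0 <= k < 2 ^ (v + u) | odd k) f (k * 2 ^ (n - v))%N.
Proof.
elim: n f => [|n IH] f.
  by rewrite [RHS]big_geq // big_pred0 // => k; rewrite dvd1n.
rewrite [in LHS]addSn [in LHS]expnSr sum_parity [RHS]big_nat_recr //= [LHS]addrC; congr (_ + _).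
  rewrite (eq_bigl (fun k => ~~ (2 ^ n %| k)%N)); last first.
    by move=> k; rewrite expnSr dvdn_pmul2r.
  rewrite (IH (fun k => f (k * 2)%N)); apply: eq_big_nat => v /andP[_ vn].
  by apply: eq_bigr => k _; rewrite -mulnA -expnSr subSn.
rewrite subnn addSn [in RHS]expnSr; apply: eq_big => [k|k _]; last by rewrite muln1.
by case: (boolP (odd k)) => //= ko; rewrite odd_ndvd_exp2.
Qed.

Lemma dbd_digits_odd w m s (y : nat -> nat) : y 1%N = 1%N ->
  (forall v, (2 <= v <= m - w s)%N -> exists b : bool, y v = (y v.-1 + b * 2 ^ v.-1)%N) ->
  forall v, (0 < v <= m - w s)%N -> odd (y v).
Proof.
move=> y1 hy; elim=> [//|[|v] IH] /andP[_ vn]; first by rewrite y1.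
have [|b ->] := hy v.+2; first by rewrite vn.
by rewrite oddD oddM oddX /= andbF addbF; apply: IH; rewrite /= ltnW.
Qed.

Lemma dbd_digits_prefix w m s (y : nat -> nat) :
  (forall v, (2 <= v <= m - w s)%N -> exists b : bool, y v = (y v.-1 + b * 2 ^ v.-1)%N) ->
  forall v n, (0 < v <= n)%N -> (n <= m - w s)%N -> exists q, y n = (y v + q * 2 ^ v)%N.
Proof.
move=> hy v; elim=> [|n IH] /andP[v0 vn] nm.
  exists 0%N; move: vn; by rewrite leqn0 => /eqP ->; rewrite addn0.
move: vn; rewrite leq_eqVlt => /predU1P[<-|]; first by exists 0%N; rewrite addn0.
rewrite ltnS => vn; have [|q yq] := IH _ (ltnW nm); first by rewrite v0.
have [|b ->] := hy n.+1; first by rewrite nm andbT ltnS (leq_trans v0).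
exists (q + b * 2 ^ (n - v))%N.
by rewrite /= yq mulnDl -mulnA -expnD subnK // addnA.
Qed.

Lemma log_product_ge0 g w z s T k : (forall j, 0 < g j) -> 0 <= log_product g w z s T k.
Proof.
move=> g0; apply: prodr_ge0 => j _.
by rewrite addr_ge0 // mulr_ge0 ?log_inv_sin2_ge0 // ltW.
Qed.

Lemma log_product_dilate g w z s u v k :
  log_product g w z s (u + v) (k * 2 ^ u) = log_product g w z s v k.
Proof.
apply: eq_bigr => j _; congr (1 + _ * L _).
rewrite mulnA natrM natrX exprD; field.
by rewrite !expf_neq0.
Qed.

(** The chosen digit does at least as well as the average of the two, and that
    average is known from one digit less.  Telescoping bounds the logarithm of
    the new component, on average over the k at which it is nonsingular and with
    the product of the previous components as weight, by its mean value ln 4. *)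
Lemma dbd_component_average g w m z s zs : (forall j, 0 < g j) ->
  (w s < m)%N -> (forall j, (j < s)%N -> (w j <= w s)%N) ->
  dbd_component g w m z s zs ->
  \sum_(0 <= k < 2 ^ m | ~~ (2 ^ (m - w s) %| k)%N)
     log_product g w z s m k * L ((2 ^ w s * zs * k)%N%:R / 2 ^+ m) <=
  ln 4 * \sum_(0 <= k < 2 ^ m | ~~ (2 ^ (m - w s) %| k)%N) log_product g w z s m k.
Proof.
move=> g0 wm wj [y [y1 hy zsE]].
set n := (m - w s)%N in hy zsE *.
have n0 : (0 < n)%N by rewrite subn_gt0.
have mE : (m = n + w s)%N by rewrite subnK // ltnW.
have hd v : (2 <= v <= n)%N -> exists b : bool, y v = (y v.-1 + b * 2 ^ v.-1)%N.
  by move=> /hy [b [_ e]]; exists b.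
have yodd := dbd_digits_odd y1 hd.
have ypre := dbd_digits_prefix hd.
pose p t k := log_product g w z s (t + w s) k.
have p0 t k : 0 <= p t k by apply: log_product_ge0.
pose S t := \sum_(0 <= k < 2 ^ (t + w s) | odd k) p t k.
pose a t v := \sum_(0 <= k < 2 ^ (t + w s) | odd k) p t k * L ((k * y v)%N%:R / 2 ^+ v).
have ln40 : 0 <= ln 4 :> R by rewrite ln_ge0 //; lra.
have lev (f : nat -> R) : \sum_(0 <= k < 2 ^ m | ~~ (2 ^ n %| k)%N) f k =
    \sum_(1 <= v < n.+1) \sum_(0 <= k < 2 ^ (v + w s) | odd k) f (k * 2 ^ (n - v))%N.
  by rewrite -sum_dyadic_levels -mE.
rewrite !lev.
have -> : \sum_(1 <= v < n.+1) \sum_(0 <= k < 2 ^ (v + w s) | odd k)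
    log_product g w z s m (k * 2 ^ (n - v)) = \sum_(1 <= v < n.+1) S v.
  apply: eq_big_nat => v /andP[_ vn]; apply: eq_bigr => k _.
  by rewrite mE -[in (n + _)%N](subnK (vn : (v <= n)%N)) -addnA log_product_dilate.
have -> : \sum_(1 <= v < n.+1) \sum_(0 <= k < 2 ^ (v + w s) | odd k)
    log_product g w z s m (k * 2 ^ (n - v)) *
    L ((2 ^ w s * zs * (k * 2 ^ (n - v)))%N%:R / 2 ^+ m) = \sum_(1 <= v < n.+1) a v v.
  apply: eq_big_nat => v /andP[v0 vn]; apply: eq_bigr => k _; congr (_ * _).
    by rewrite mE -[in (n + _)%N](subnK (vn : (v <= n)%N)) -addnA log_product_dilate.
  have [|q yq] := ypre v n _ (leqnn n); first by rewrite v0.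
  (* zs = y v + q 2^v, so that k zs / 2^v and k (y v) / 2^v differ by k q *)
  rewrite -[in RHS](log_inv_sin2_period _ (k * q)); congr L.
  rewrite zsE yq {1}mE -[in (n + _)%N](subnK (vn : (v <= n)%N)).
  rewrite !(natrM, natrD, natrX, exprD); field.
  by rewrite !expf_neq0.
apply: digit_telescope => //.
- by move=> t; apply: sumr_ge0 => k _; apply: p0.
- move=> t; apply: big1 => k ko.
  by rewrite y1 muln1 expr1 log_inv_sin2_half_odd // mulr0.
move=> v /andP[v1 vn]; have [|b [hmin yv]] := hy v; first by rewrite v1.
have v0 : (0 < v)%N by apply: ltnW.
pose Q x := \sum_(v <= t < n.+1) 1 / 2 ^+ (t - v) *
    \sum_(0 <= k < 2 ^ (t + w s) | odd k) p t k * (1 + g s * L ((k * x)%N%:R / 2 ^+ v)).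
have QE x : quality g w m z s v x = Q x by apply: quality_log_product => //; apply: ltnW.
have avg : Q (y v) <= (Q (y v.-1) + Q (y v.-1 + 2 ^ v.-1)%N) / 2.
  have := hmin false; have := hmin true; rewrite -yv !QE mul0n addn0 mul1n; lra.
have xo : odd (y v.-1) by apply: yodd; lia.
have QyE : Q (y v) = \sum_(v <= t < n.+1) 1 / 2 ^+ (t - v) * S t +
   g s * \sum_(v <= t < n.+1) 1 / 2 ^+ (t - v) * a t v.
  rewrite mulr_sumr -big_split; apply: eq_bigr => t _ /=.
  have -> : \sum_(0 <= k < 2 ^ (t + w s) | odd k)
      p t k * (1 + g s * L ((k * y v)%N%:R / 2 ^+ v)) = S t + g s * a t v.
    rewrite /S /a [g s * _]mulr_sumr -big_split.
    by apply: eq_bigr => k _ /=; ring.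
  by ring.
have Q2E : (Q (y v.-1) + Q (y v.-1 + 2 ^ v.-1)%N) / 2 =
  \sum_(v <= t < n.+1) 1 / 2 ^+ (t - v) * S t +
  g s * \sum_(v <= t < n.+1) 1 / 2 ^+ (t - v) * ((ln 4 * S t + a t v.-1) / 2).
  rewrite [g s * _]mulr_sumr -!big_split mulr_suml; apply: eq_bigr => t _ /=.
  have e : \sum_(0 <= k < 2 ^ (t + w s) | odd k)
      p t k * (1 + g s * L ((k * y v.-1)%N%:R / 2 ^+ v)) +
     \sum_(0 <= k < 2 ^ (t + w s) | odd k)
      p t k * (1 + g s * L ((k * (y v.-1 + 2 ^ v.-1))%N%:R / 2 ^+ v)) =
     2 * S t + g s * (ln 4 * S t + a t v.-1).
    rewrite /S /a !mulr_sumr -!big_split mulr_sumr -big_split.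
    apply: eq_bigr => k ko /=.
    have := log_inv_sin2_digit_average ko xo v1 => h.
    have -> : L ((k * y v.-1)%N%:R / 2 ^+ v.-1) =
      L ((k * y v.-1)%N%:R / 2 ^+ v) + L ((k * (y v.-1 + 2 ^ v.-1))%N%:R / 2 ^+ v) - ln 4.
      by rewrite h; ring.
    by ring.
  by rewrite -mulrDr e; field; rewrite expf_neq0.
by move: avg; rewrite QyE Q2E lerD2l ler_pM2l.
Qed.

End ReducedSearch.

(** * Components of an output of the search *)

Section MeanProduct.
Context {R : realType}.
Local Notation L := (@log_inv_sin2 R).
Implicit Types (g : nat -> R) (w z : nat -> nat) (m s v t k x n d : nat) (lam : R).

Lemma sum_nondvd_exp2 (f : nat -> R) m :
  \sum_(0 <= k < 2 ^ m | ~~ (2 ^ m %| k)%N) f k = \sum_(1 <= k < 2 ^ m) f k.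
Proof.
rewrite big_ltn_cond ?expn_gt0 // dvdn0 /= big_nat_cond [RHS]big_nat_cond.
apply: eq_bigl => k; rewrite andbT andbC; case: (boolP (_ <= _ < _)%N) => [/andP[k1 kN]|].
  by rewrite andbT gtnNdvd.
by rewrite andbF.
Qed.

(** The terms for k and k + 2^m add up to ln 4 plus a term of the previous level;
    the unpaired term at 1/2 vanishes. *)
Lemma sum_log_inv_sin2_le m :
  \sum_(1 <= k < 2 ^ m) L (k%:R / 2 ^+ m) <= ln 4 * \sum_(1 <= k < 2 ^ m) 1.
Proof.
have ln40 : 0 <= ln 4 :> R by rewrite ln_ge0 //; lra.
elim: m => [|m IH]; first by rewrite !big_geq // mulr0.
have N0 : (0 < 2 ^ m)%N by rewrite expn_gt0.
have p0 : 2 ^+ m != 0 :> R by rewrite expf_neq0.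
rewrite expnS mul2n -addnn ![\sum_(1 <= k < 2 ^ m + 2 ^ m) _](big_cat_nat (n := 2 ^ m)) ?leq_addr //=.
have shift (f : nat -> R) : \sum_(2 ^ m <= k < 2 ^ m + 2 ^ m) f k =
    f (2 ^ m)%N + \sum_(1 <= k < 2 ^ m) f (k + 2 ^ m)%N.
  by rewrite -{1}[(2 ^ m)%N]add0n big_addn addnK big_ltn.
rewrite !shift addrCA.
have -> : L ((2 ^ m)%N%:R / 2 ^+ m.+1) = 0.
  have -> : (2 ^ m)%N%:R / 2 ^+ m.+1 = 1%N%:R / 2 :> R.
    by rewrite natrX exprS; field.
  exact: log_inv_sin2_half_odd.
rewrite add0r -big_split /=.
have -> : \sum_(1 <= k < 2 ^ m) (L (k%:R / 2 ^+ m.+1) + L ((k + 2 ^ m)%N%:R / 2 ^+ m.+1)) =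
   ln 4 * (\sum_(1 <= k < 2 ^ m) 1) + \sum_(1 <= k < 2 ^ m) L (k%:R / 2 ^+ m).
  rewrite mulr_sumr -big_split; apply: eq_big_nat => k /andP[k1 kN] /=.
  have e1 : k%:R / 2 ^+ m = 2 * (k%:R / 2 ^+ m.+1) :> R by rewrite exprS; field.
  have -> : (k + 2 ^ m)%N%:R / 2 ^+ m.+1 = k%:R / 2 ^+ m.+1 + 1 / 2 :> R.
    by rewrite natrD natrX exprS; field.
  rewrite e1 log_inv_sin2_double ?mulr1 // -e1; apply: sin_dyadic_neq0.
  by rewrite gtnNdvd.
move: IH; set A := \sum_(1 <= k < 2 ^ m) 1; nra.
Qed.

(** What the error analysis needs to know of component s, whether it was found by
    the search, fixed to 1 as the first one, or is singular everywhere. *)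
Definition good_average g w m z s :=
  \sum_(0 <= k < 2 ^ m | ~~ (2 ^ (m - w s) %| k)%N)
     log_product g w z s m k * L ((2 ^ w s * z s * k)%N%:R / 2 ^+ m) <=
  ln 4 * \sum_(0 <= k < 2 ^ m | ~~ (2 ^ (m - w s) %| k)%N) log_product g w z s m k.

Lemma leq_mono w : (forall j, (w j <= w j.+1)%N) ->
  forall i j, (i <= j)%N -> (w i <= w j)%N.
Proof. by move=> h; apply: homo_leq leqnn leq_trans h. Qed.

Lemma ltn_dstar w m d s : (forall j, (w j <= w j.+1)%N) -> (s < d)%N ->
  (s < dstar w m d)%N = (w s < m)%N.
Proof.
move=> wm sd; apply/idP/idP => [|ws]; last first.
  exact: (leq_bigmax_cond (Ordinal sd) ws (F := fun j : 'I_d => j.+1)).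
apply: contraLR; rewrite -!leqNgt => mw.
apply/bigmax_leqP => j wj; rewrite ltnNge; apply/negP => sj.
by have := leq_mono wm sj; lia.
Qed.

Lemma reduced_cbc_dbd_good g w m d (Z : 'rV[int]_d) : w 0%N = 0%N ->
  (forall j, (w j <= w j.+1)%N) -> (forall j, 0 < g j) -> (0 < m)%N ->
  reduced_cbc_dbd g w m Z ->
  exists z : nat -> nat,
    [/\ forall j, odd (z j),
        forall j, (j < d)%N -> entry Z j = (2 ^ w j * z j)%N%:Z &
        forall s, (s < d)%N -> good_average g w m z s].
Proof.
move=> w0 wm g0 m0 [z [z0 zhi hs ZE]].
pose z' j := if (j < d)%N then z j else 1%N.
have zz j : (j < d)%N -> z' j = z j by rewrite /z' => ->.
have lp s T k : (s <= d)%N -> log_product g w z' s T k = log_product g w z s T k.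
  by move=> sd; apply: eq_bigr => j _; rewrite zz // (leq_trans (ltn_ord j)).
(* The entries of z beyond d are arbitrary, hence the replacement by 1. *)
exists z'; split.
- move=> j; rewrite /z'; case: ifP => // jd.
  have [wj|mw] := ltnP (w j) m; last first.
    by rewrite zhi // jd andbT leqNgt ltn_dstar // -leqNgt.
  case: j jd wj => [|j] jd wj; first by rewrite z0.
  have [|y [y1 hy ->]] := hs j.+1; first by rewrite /= ltn_dstar.
  apply: (dbd_digits_odd (w := w) (m := m) (s := j.+1) y1).
    by move=> v /hy [b [_ e]]; exists b.
  by rewrite leqnn subn_gt0 wj.
- by move=> j jd; rewrite zz // (entryE Z (Ordinal jd) : entry Z j = _) ZE mxE.
move=> s sd; rewrite /good_average zz //.
under eq_bigr => k _ do rewrite lp ?(ltnW sd) //.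
under [X in _ <= _ * X]eq_bigr => k _ do rewrite lp ?(ltnW sd) //.
have [ws|mw] := ltnP (w s) m; last first.
  by move/eqP: mw => ->; rewrite !big_pred0 ?mulr0 // => k; rewrite dvd1n.
case: s sd ws => [|s] sd ws.
  rewrite w0 subn0 z0 !sum_nondvd_exp2 /log_product.
  apply: (@le_trans _ _ (ln 4 * \sum_(1 <= k < 2 ^ m) 1)).
    apply: le_trans (sum_log_inv_sin2_le m).
    apply: ler_sum => k _; by rewrite big_ord0 mul1r expn0 !mul1n.
  rewrite ler_wpM2l ?ln_ge0 //; first by lra.
  by apply: ler_sum => k _; rewrite big_ord0.
apply: dbd_component_average => // [j js|]; first by rewrite leq_mono // ltnW.
by apply: hs; rewrite /= ltn_dstar.
Qed.

End MeanProduct.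

(** * The mean of the product of logarithms *)

Section ProductRecursion.
Context {R : realType}.
Local Notation L := (@log_inv_sin2 R).
Implicit Types (g : nat -> R) (w z : nat -> nat) (m s v t k x n d : nat) (lam : R).

(** At the singular k, where the logarithm has the default value 0, lam stands for
    a bound of the damped kernel. *)
Definition truncated_log w z m lam (j k : nat) : R :=
  if (2 ^ (m - w j) %| k)%N then lam else L ((2 ^ w j * z j * k)%N%:R / 2 ^+ m).

Lemma ndvd_odd_mul m u (zj k : nat) : odd zj -> ~~ (2 ^ (m - u) %| k)%N ->
  ~~ (2 ^ m %| 2 ^ u * zj * k)%N.
Proof.
move=> zo; have [mu|um] := leqP m u.
  by move/eqP: mu => ->; rewrite dvd1n.
apply: contraNN; rewrite -{1}(subnK (ltnW um)) expnD mulnC -mulnA dvdn_pmul2l ?expn_gt0 //.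
by rewrite Gauss_dvdr // coprimeXl // coprime2n.
Qed.

Lemma card_dvd_exp2 m u : (\sum_(0 <= k < 2 ^ m | 2 ^ (m - u) %| k) 1 <= 2 ^ u)%N.
Proof.
apply: leq_trans (card_dvd_mul_exp2 m u 0 (isT : odd 1)).
rewrite big_mkord big_mkcond; apply: leq_sum => k _; case: ifP => // h.
rewrite add0r muln1 -PoszM dvdzE /=.
suff -> : (2 ^ m %| k * 2 ^ u)%N by [].
move: h; move: (k : nat) => {}k h.
have [mu|um] := leqP m u; first by rewrite dvdn_mull // dvdn_exp2l.
by rewrite -(subnK (ltnW um)) expnD dvdn_mul.
Qed.

Lemma truncated_log_ge0 w z m lam j k : 0 <= lam -> 0 <= truncated_log w z m lam j k.
Proof. by rewrite /truncated_log; case: ifP => // _ _; apply: log_inv_sin2_ge0. Qed.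

Lemma truncated_log_le w z m lam j k : odd (z j) -> m%:R * ln 4 <= lam ->
  truncated_log w z m lam j k <= lam.
Proof.
move=> zo hl; rewrite /truncated_log; case: ifPn => // nd.
apply: le_trans hl; apply: log_inv_sin2_dyadic_le; exact: ndvd_odd_mul.
Qed.

(** One component at a time: where the new component is nonsingular, so are the
    previous ones and its weighted average is at most ln 4; the at most 2^w_s
    remaining k are bounded crudely. *)
Lemma sum_truncated_product g w z m d lam Lam : (forall j, 0 < g j) ->
  (forall j, (w j <= w j.+1)%N) -> (forall j, odd (z j)) ->
  m%:R * ln 4 <= lam ->
  (forall s, (s <= d)%N -> \prod_(j < s) (1 + g j * lam) <= Lam) ->
  (forall s, (s < d)%N -> good_average g w m z s) ->
  \sum_(0 <= k < 2 ^ m) \prod_(j < d) (1 + g j * truncated_log w z m lam j k) <=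
  \prod_(j < d) (1 + g j * ln 4) *
    (2 ^+ m + (\sum_(j < d) g j * 2 ^+ w j) * (lam * Lam)).
Proof.
move=> g0 wm zo hl hLam hgood.
have ln40 : 0 <= ln 4 :> R by rewrite ln_ge0 //; lra.
have lam0 : 0 <= lam by apply: le_trans hl; rewrite mulr_ge0.
have Lam0 : 0 <= Lam by apply: le_trans (hLam 0%N _); rewrite ?big_ord0.
suff : forall s, (s <= d)%N ->
  \sum_(0 <= k < 2 ^ m) \prod_(j < s) (1 + g j * truncated_log w z m lam j k) <=
  \prod_(j < s) (1 + g j * ln 4) *
    (2 ^+ m + (\sum_(j < s) g j * 2 ^+ w j) * (lam * Lam)) by apply.
elim=> [|s IH] sd.
  rewrite !big_ord0 mul0r addr0 mul1r; under eq_bigr => k _ do rewrite big_ord0.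
  by rewrite sumr_const_nat subn0 natrX.
pose X k := \prod_(j < s) (1 + g j * truncated_log w z m lam j k).
have X0 k : 0 <= X k.
  by apply: prodr_ge0 => j _; rewrite addr_ge0 // mulr_ge0 ?truncated_log_ge0 // ltW.
have XLam k : X k <= Lam.
  apply: le_trans (hLam s (ltnW sd)); apply: ler_prod => j _.
  rewrite addr_ge0 ?mulr_ge0 ?truncated_log_ge0 ?(ltW (g0 _)) //=.
  by rewrite lerD2l ler_wpM2l ?truncated_log_le // ltW.
have {}IH := IH (ltnW sd).
set M := \sum_(0 <= k < 2 ^ m) _ in IH.
pose bad k := (2 ^ (m - w s) %| k)%N.
have XE k : ~~ bad k -> X k = log_product g w z s m k.
  move=> nb; apply: eq_bigr => j _; congr (1 + _ * _).
  rewrite /truncated_log ifN //; apply: contraNN nb; apply: dvdn_trans.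
  by rewrite dvdn_exp2l // leq_sub2l // leq_mono // ltnW.
have good : \sum_(0 <= k < 2 ^ m | ~~ bad k) X k * truncated_log w z m lam s k <= ln 4 * M.
  apply: (@le_trans _ _ (ln 4 * \sum_(0 <= k < 2 ^ m | ~~ bad k) X k)); last first.
    by rewrite ler_wpM2l // /M [leRHS](bigID bad) /= lerDr sumr_ge0 // => k _; apply: X0.
  rewrite [X in _ <= _ * X](eq_bigr (log_product g w z s m)); last first.
    by move=> k nb; rewrite XE.
  apply: le_trans (hgood s sd); apply: eq_ler.
  apply: eq_bigr => k nb; rewrite XE //; congr (_ * _).
  by rewrite /truncated_log -/(bad k) (negbTE nb).
have badle : \sum_(0 <= k < 2 ^ m | bad k) X k * truncated_log w z m lam s k <=
    2 ^+ w s * (lam * Lam).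
  apply: (@le_trans _ _ (\sum_(0 <= k < 2 ^ m | bad k) 1%N%:R * (lam * Lam))).
    apply: ler_sum => k _; rewrite mul1r mulrC ler_pM ?truncated_log_ge0 //.
    exact: truncated_log_le.
  rewrite -mulr_suml ler_wpM2r ?mulr_ge0 // -natr_sum -natrX ler_nat.
  exact: card_dvd_exp2.
have -> : \sum_(0 <= k < 2 ^ m) \prod_(j < s.+1) (1 + g j * truncated_log w z m lam j k) =
  M + g s * \sum_(0 <= k < 2 ^ m) X k * truncated_log w z m lam s k.
  rewrite mulr_sumr -big_split; apply: eq_bigr => k _.
  by rewrite big_ord_recr /= -/(X k); ring.
rewrite [X in _ + g s * X <= _](bigID bad) /=.
apply: (@le_trans _ _ (M + g s * (2 ^+ w s * (lam * Lam) + ln 4 * M))).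
  by rewrite lerD2l ler_wpM2l ?lerD // ltW.
rewrite !big_ord_recr /=.
move: IH; set P := \prod_(j < s) _; set V := \sum_(j < s) _ => IH.
have P1 : 1 <= P.
  rewrite /P; elim/big_ind: _ => // [x y x1 y1|j _]; first exact: mulr_ege1.
  by rewrite lerDl mulr_ge0 // ltW.
have gl : 0 <= g s * ln 4 by rewrite mulr_ge0 // ltW.
have E0 : 0 <= g s * 2 ^+ w s * (lam * Lam).
  by rewrite !mulr_ge0 ?exprn_ge0 // ltW.
have h1 : (1 + g s * ln 4) * M <= (1 + g s * ln 4) * (P * (2 ^+ m + V * (lam * Lam))).
  by rewrite ler_wpM2l // addr_ge0.
have h2 : g s * 2 ^+ w s * (lam * Lam) <=
    P * (1 + g s * ln 4) * (g s * 2 ^+ w s * (lam * Lam)).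
  by rewrite ler_peMl // mulr_ege1 // lerDl.
lra.
Qed.

End ProductRecursion.

(** * Growth estimates *)

Section Growth.
Context {R : realType}.
Implicit Types (g u : nat -> R) (n m d : nat) (alpha delta eps S x : R).

Lemma expR_sub1_le x : 0 <= x -> expR x - 1 <= x * expR x.
Proof.
move=> x0; have h : expR x * (1 - x) <= expR x * expR (- x).
  by rewrite ler_wpM2l ?expR_ge0 // expR_ge1Dx.
rewrite expRxMexpNx_1 in h; lra.
Qed.

Lemma prod_1D_le_expR (I : Type) (r : seq I) (P : pred I) (F : I -> R) :
  (forall i, 0 <= F i) -> \prod_(i <- r | P i) (1 + F i) <= expR (\sum_(i <- r | P i) F i).
Proof.
move=> F0; rewrite expR_sum; apply: ler_prod => i _.
by rewrite expR_ge1Dx andbT addr_ge0.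
Qed.

Lemma nneseries_partial_le u : (forall j, 0 <= u j) ->
  (\sum_(0 <= j <oo) (u j)%:E < +oo)%E ->
  exists2 S, 0 <= S & forall n, \sum_(j < n) u j <= S.
Proof.
move=> u0 fin; set s := (\sum_(0 <= j <oo) _)%E in fin.
have s0 : (0 <= s)%E by apply: nneseries_ge0 => j _ _; rewrite lee_fin.
exists (fine s); first exact: fine_ge0.
move=> n; rewrite -lee_fin fineK ?ge0_fin_numE // -sumEFin -(big_mkord xpredT (fun j => (u j)%:E)).
by apply: nneseries_lim_ge => j _ _; rewrite lee_fin.
Qed.

Lemma bounded_sum_tail u S eps : (forall j, 0 <= u j) ->
  (forall n, \sum_(j < n) u j <= S) -> 0 < eps ->
  exists J, forall n, \sum_(J <= j < n) u j <= eps.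
Proof.
move=> u0 uS e0; pose E := [set \sum_(j < n) u j | n in setT]%classic.
have hE : has_sup E.
  split; first by exists (\sum_(j < 0) u j); exists 0%N.
  by exists S => _ [n _ <-].
have [_ [J _ <-] hJ] := sup_adherent e0 hE.
exists J => n; have [nJ|Jn] := leqP n J; first by rewrite big_geq // ltW.
have : \sum_(j < n) u j <= sup E by apply: sup_upper_bound => //; exists n.
rewrite -(big_mkord xpredT) (big_cat_nat (n := J)) ?(ltnW Jn) //= big_mkord.
move: hJ; lra.
Qed.

(** Only finitely many factors matter beyond an arbitrarily small exponential
    rate, and each of those is dominated by exp (theta m). *)
Lemma prod_growth u S delta : (forall j, 0 <= u j) ->
  (forall n, \sum_(j < n) u j <= S) -> 0 < delta ->
  exists2 C, 0 < C & forall d m, \prod_(j < d) (1 + u j * m%:R) <= C * expR (delta * m%:R).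
Proof.
move=> u0 uS d0; have h0 : 0 < delta / 2 by lra.
have [J hJ] := bounded_sum_tail u0 uS h0.
pose theta := delta / 2 / J.+1%:R.
have t0 : 0 < theta by rewrite divr_gt0.
exists (\prod_(j < J) (1 + u j / theta)).
  by apply: prodr_gt0 => j _; rewrite ltr_wpDr // divr_ge0 // ltW.
have head m : \prod_(j < J) (1 + u j * m%:R) <=
    (\prod_(j < J) (1 + u j / theta)) * expR (delta / 2 * m%:R).
  apply: (@le_trans _ _ (\prod_(j < J) ((1 + u j / theta) * expR (theta * m%:R)))).
    apply: ler_prod => j _; rewrite addr_ge0 ?mulr_ge0 //=.
    have e1 := expR_ge1Dx (theta * m%:R).
    have p1 : 0 <= 1 + u j / theta by rewrite addr_ge0 // divr_ge0 // ltW.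
    apply: le_trans (ler_wpM2l p1 e1).
    have -> : (1 + u j / theta) * (1 + theta * m%:R) =
       1 + u j * m%:R + (u j / theta + theta * m%:R) by field; rewrite gt_eqF.
    by rewrite lerDl addr_ge0 ?divr_ge0 ?mulr_ge0 // ltW.
  rewrite big_split /= ler_wpM2l //.
    by apply: prodr_ge0 => j _; rewrite addr_ge0 // divr_ge0 // ltW.
  rewrite prodr_const card_ord -expRM_natl ler_expR.
  rewrite mulrA ler_wpM2r // /theta mulrCA ler_piMr //; first lra.
  by rewrite ler_pdivrMr // mul1r ler_nat.
move=> d m; set C := \prod_(j < J) _.
have C0 : 0 <= C by apply: prodr_ge0 => j _; rewrite addr_ge0 // divr_ge0 // ltW.
apply: (@le_trans _ _ ((\prod_(j < J) (1 + u j * m%:R)) *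
   \prod_(J <= j < maxn d J) (1 + u j * m%:R))).
  rewrite -!(big_mkord xpredT (fun j => 1 + u j * m%:R)) -big_cat_nat ?leq_maxr //=.
  rewrite [leRHS](big_cat_nat (n := d)) ?leq_maxl //= ler_peMr //.
    by apply: prodr_ge0 => j _; rewrite addr_ge0 // mulr_ge0.
  elim/big_ind: _ => // [x y x1 y1|j _]; first exact: mulr_ege1.
  by rewrite lerDl mulr_ge0.
have -> : delta * m%:R = delta / 2 * m%:R + delta / 2 * m%:R by field.
rewrite expRD mulrA ler_pM ?head //.
- by apply: prodr_ge0 => j _; rewrite addr_ge0 // mulr_ge0.
- by apply: prodr_ge0 => j _; rewrite addr_ge0 // mulr_ge0.
apply: le_trans (prod_1D_le_expR _ _ _) _ => [j|]; first by rewrite mulr_ge0.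
by rewrite ler_expR -mulr_suml ler_wpM2r.
Qed.

(** The q between 2^i and 2^(i+1) contribute at most r^i, r = 2^(1 - alpha) < 1. *)
Lemma zeta_bound alpha : 1 < alpha ->
  exists2 C, 0 <= C & forall n, \sum_(1 <= q < n) (q%:R `^ alpha)^-1 <= C.
Proof.
move=> a1; pose r : R := 2 `^ (1 - alpha).
have r0 : 0 < r by apply: powR_gt0.
have r1 : r < 1.
  rewrite /r /powR ifF; last by rewrite gt_eqF.
  rewrite expR_lt1 nmulr_rlt0; last lra.
  by rewrite ln_gt0 //; lra.
have C0 : 0 <= (1 - r)^-1 by rewrite invr_ge0; lra.
exists (1 - r)^-1 => // n.
have pos q : 0 <= (q%:R `^ alpha)^-1 :> R by rewrite invr_ge0 powR_ge0.
have dyadic I : \sum_(1 <= q < 2 ^ I) (q%:R `^ alpha)^-1 <= \sum_(i < I) r ^+ i.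
  elim: I => [|I IH]; first by rewrite big_geq // big_ord0.
  rewrite expnS mul2n -addnn (big_cat_nat (n := (2 ^ I)%N)) ?leq_addr ?expn_gt0 //=.
  rewrite big_ord_recr /= lerD //.
  apply: (@le_trans _ _ (\sum_(2 ^ I <= q < 2 ^ I + 2 ^ I) (((2 ^ I)%N%:R `^ alpha)^-1 : R))).
    rewrite big_nat_cond [leRHS]big_nat_cond; apply: ler_sum => q /andP[/andP[q1 _] _].
    rewrite lef_pV2 ?posrE ?powR_gt0 ?ltr0n ?expn_gt0 ?(leq_trans _ q1) ?expn_gt0 //.
    by rewrite ge0_ler_powR ?nnegrE ?ler_nat //; lra.
  rewrite sumr_const_nat addnK /r -powR_mulrn ?powR_ge0 // -powRrM mulrC powRrM powR_mulrn //.
  rewrite -natrX powRB; last by apply/implyP => _; rewrite pnatr_eq0 expn_eq0.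
  by rewrite powRr1 // mulr_natl.
have nn : (n <= 2 ^ n)%N by apply: ltnW; apply: ltn_expl.
have [n0|n0] := leqP n 0; first by rewrite big_geq // (leq_trans n0).
apply: (@le_trans _ _ (\sum_(1 <= q < 2 ^ n) (q%:R `^ alpha)^-1)).
  by rewrite [leRHS](big_cat_nat (n := n)) //= lerDl sumr_ge0.
apply: (le_trans (dyadic n)).
have := subrX1 r n => h.
have : (1 - r) * \sum_(i < n) r ^+ i <= 1.
  have : 0 <= r ^+ n by rewrite exprn_ge0 // ltW.
  have -> : (1 - r) * \sum_(i < n) r ^+ i = - ((r - 1) * \sum_(i < n) r ^+ i) by ring.
  rewrite -h; lra.
by rewrite -[X in _ -> _ <= X]mul1r ler_pdivlMr ?subr_gt0 // mulrC.
Qed.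

End Growth.

(** * The two parts of the error *)

Section ErrorBound.
Context {R : realType}.
Local Notation L := (@log_inv_sin2 R).
Implicit Types (g : nat -> R) (w z : nat -> nat) (m d n : nat) (alpha S Lam : R).

Lemma exp2_ge1 n : 1 <= 2 ^+ n :> R.
Proof. by rewrite exprn_ege1 // ler1n. Qed.

Lemma lattice_sum_ext N n (phi psi : nat -> nat -> R) (Z Z' : nat -> int) s c :
  (forall j, (j < s)%N -> phi j = psi j /\ Z j = Z' j) ->
  lattice_sum N n phi Z s c = lattice_sum N n psi Z' s c.
Proof.
elim: s c => [//|s IH] c h /=; have [-> ->] := h s (ltnSn s).
have {}IH c' : lattice_sum N n phi Z s c' = lattice_sum N n psi Z' s c'.
  by apply: IH => j js; apply: h; rewrite ltnW.
by rewrite IH; congr (_ + _); apply: eq_bigr => a _; rewrite !IH.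
Qed.

Lemma decay_weight_powR alpha g j a : (forall j, 0 < g j) ->
  decay_weight alpha (fun j => g j `^ alpha) j a = decay_weight 1 g j a `^ alpha.
Proof.
move=> g0; rewrite /decay_weight; case: ifP => _; first by rewrite powR1.
rewrite powRM ?invr_ge0 ?powR_ge0 ?ltW // powRr1 //.
by rewrite -[a%:R^-1]powR_inv1 // -powRrM mulN1r powRN.
Qed.

Lemma decay_weight_ge0 alpha g j a : (forall j, 0 < g j) -> 0 <= decay_weight alpha g j a.
Proof.
by move=> g0; rewrite /decay_weight; case: ifP => // _; rewrite divr_ge0 ?powR_ge0 // ltW.
Qed.

(** The additive error is moved into a factor of its own, 1 + t + e being at most
    (1 + t) (1 + e). *)
Lemma truncated_kernel_le g w z m j k (G : R) : (forall j, 0 < g j) ->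
  odd (z j) -> G <= 14 * m%:R ->
  (~~ (2 ^ m %| 2 ^ w j * z j * k)%N ->
     G <= L ((2 ^ w j * z j * k)%N%:R / 2 ^+ m) + 17 * m%:R / 2 ^+ m) ->
  1 + g j * G <=
  (1 + g j * truncated_log w z m (14 * m%:R) j k) * (1 + g j * (17 * m%:R / 2 ^+ m)).
Proof.
move=> g0 zo h1 h2; set e := 17 * m%:R / 2 ^+ m in h2 *.
have e0 : 0 <= e by rewrite divr_ge0 ?exprn_ge0 // mulr_ge0.
have t0 : 0 <= truncated_log w z m (14 * m%:R : R) j k by apply: truncated_log_ge0; rewrite mulr_ge0.
have : G <= truncated_log w z m (14 * m%:R : R) j k + e.
  rewrite /truncated_log; case: ifPn => nd; first by lra.
  by apply: h2; apply: ndvd_odd_mul.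
have gj := g0 j; set t := truncated_log _ _ _ _ _ _ in t0 * => ht.
have := ler_wpM2l (ltW gj) ht.
have : 0 <= g j * t * (g j * e) by rewrite !mulr_ge0 // ltW.
lra.
Qed.

(** Replacing the coefficients 1 / a by those of the damped kernel, whose constant
    term is at least ln 4, turns the sum into the excess of a mean of products
    over prod_j (1 + g_j ln 4). *)
Lemma box_sum_le g w z m d S Lam : (forall j, 0 < g j) ->
  (forall j, (w j <= w j.+1)%N) -> (forall j, odd (z j)) -> (0 < m)%N ->
  (forall n, \sum_(j < n) g j * 2 ^+ w j <= S) ->
  (forall s, (s <= d)%N -> \prod_(j < s) (1 + g j * (14 * m%:R)) <= Lam) ->
  (forall s, (s < d)%N -> good_average g w m z s) ->
  lattice_sum_nz (2 ^ m) (2 ^ m) (decay_weight 1 g)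
     (fun j => (2 ^ w j * z j)%N%:Z) d 0 <=
  31 * S * expR (19 * S) * (m%:R * Lam / 2 ^+ m).
Proof.
move=> g0 wm zo m0 hS hLam hgood.
set Z := fun j => (2 ^ w j * z j)%N%:Z; set N : R := 2 ^+ m.
have N0 : 0 < N by rewrite exprn_gt0.
have S0 : 0 <= S by apply: le_trans (hS 0%N); rewrite big_ord0.
have Lam1 : 1 <= Lam by apply: le_trans (hLam 0%N _); rewrite ?big_ord0.
have mN : m%:R <= N by rewrite /N -natrX ler_nat ltnW // ltn_expl.
have gS n : \sum_(j < n) g j <= S.
  apply: le_trans (hS n); apply: ler_sum => j _.
  by rewrite ler_peMr ?exp2_ge1 // ltW.
have [n [kap [nN kap0 kap4 kapa kapG]]] := @damped_log_kernel R m m0.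
pose phi j a := if a == 0%N then 1 + g j * kap 0%N else g j * kap a.
have phi0 j a : 0 <= phi j a.
  by rewrite /phi; case: ifP => _; rewrite ?addr_ge0 ?mulr_ge0 // ltW.
apply: (@le_trans _ _ (lattice_sum_nz (2 ^ m) n phi Z d 0)).
  apply: lattice_sum_nz_le => // [j a|j a aN]; first exact: decay_weight_ge0.
  rewrite /decay_weight /phi; case: eqP => [_|/eqP a0].
    by rewrite lerDl mulr_ge0 // ltW.
  rewrite powRr1 // ler_wpM2l ?(ltW (g0 _)) //.
  by apply: kapa; rewrite lt0n a0.
pose G j k := kap 0%N + \sum_(a < n) 2 * kap a.+1 * charc m k (a.+1%:Z * Z j).
pose e : R := 17 * m%:R / N; pose E := \prod_(j < d) (1 + g j * e).
pose P := \prod_(j < d) (1 + g j * ln 4).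
have ln40 := @ln4_ge0 R.
have e0 : 0 <= e by rewrite divr_ge0 ?mulr_ge0 // ltW.
have E1 : 0 <= E by apply: prodr_ge0 => j _; rewrite addr_ge0 // mulr_ge0 // ltW.
have P1 : 0 <= P by apply: prodr_ge0 => j _; rewrite addr_ge0 // mulr_ge0 // ltW.
have mean : lattice_sum (2 ^ m) n phi Z d 0 <=
    P * (1 + S * (14 * m%:R * Lam) / N) * E.
  rewrite -(ler_pM2l N0) lattice_sum_charc.
  apply: (@le_trans _ _ (\sum_(0 <= k < 2 ^ m)
     (\prod_(j < d) (1 + g j * truncated_log w z m (14 * m%:R) j k)) * E)).
    rewrite big_mkord; apply: ler_sum => k _.
    rewrite {1}/charc mul0r mulr0 mulr0 mul0r cos0 mul1r /E -big_split /=.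
    apply: ler_prod => j _.
    have -> : phi j 0%N + \sum_(a < n) 2 * phi j a.+1 * charc m k (a.+1%:Z * Z j) = 1 + g j * G j k.
      rewrite /phi /= /G mulrDr mulr_sumr addrA; congr (_ + _).
      by apply: eq_bigr => a _; ring.
    have [G0 G1 G2] := kapG (2 ^ w j * z j)%N k.
    rewrite addr_ge0 ?mulr_ge0 // ?(ltW (g0 _)) //=.
    exact: truncated_kernel_le.
  rewrite -mulr_suml.
  have l14 : m%:R * ln 4 <= 14 * m%:R :> R.
    have : m%:R * ln 4 <= m%:R * 2 :> R by rewrite ler_wpM2l // ln4_le2.
    have : 0 <= m%:R :> R by []. lra.
  have h := sum_truncated_product g0 wm zo l14 hLam hgood.
  apply: le_trans (ler_wpM2r E1 h) _.
  rewrite -/P -/N.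
  have -> : N * (P * (1 + S * (14 * m%:R * Lam) / N) * E) =
    P * (N + S * (14 * m%:R * Lam)) * E by field; rewrite gt_eqF.
  rewrite ler_wpM2r // ler_wpM2l // lerD2l ler_wpM2r //.
  by rewrite !mulr_ge0 //; lra.
rewrite /lattice_sum_nz dvdz0 mul1r.
apply: (@le_trans _ _ (P * (1 + S * (14 * m%:R * Lam) / N) * E - P)).
  rewrite lerB // /P; apply: ler_prod => j _.
  by rewrite /phi eqxx lerD2l ler_wpM2l // ?addr_ge0 ?mulr_ge0 // ltW.
have PS : P <= expR (2 * S).
  apply: le_trans (prod_1D_le_expR _ _ _) _ => [j|]; first by rewrite mulr_ge0 // ltW.
  rewrite ler_expR -mulr_suml mulrC ler_pM ?ln4_le2 //.
  by apply: sumr_ge0 => j _; apply: ltW.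
have Ee : E <= expR (S * e).
  apply: le_trans (prod_1D_le_expR _ _ _) _ => [j|]; first by rewrite mulr_ge0 // ltW.
  by rewrite ler_expR -mulr_suml ler_wpM2r.
have Se : 0 <= S * e by rewrite mulr_ge0.
have e17 : e <= 17 by rewrite /e ler_pdivrMr // ler_wpM2l.
have Ee17 : expR (S * e) <= expR (17 * S) by rewrite ler_expR mulrC ler_wpM2r.
have E17 : E <= expR (17 * S) by apply: le_trans Ee Ee17.
pose q := m%:R * Lam / N.
have eq : e <= 17 * q.
  rewrite /e /q [17 * (_ / _)]mulrA ler_wpM2r ?invr_ge0 ?(ltW N0) // mulrA.
  by rewrite ler_peMr // mulr_ge0.
have E1' : E - 1 <= 17 * S * q * expR (17 * S).
  have h1 : E - 1 <= S * e * expR (S * e) by apply: le_trans (expR_sub1_le Se); lra.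
  apply: (le_trans h1); rewrite ler_pM ?expR_ge0 //.
  have := ler_wpM2l S0 eq; lra.
have q0 : 0 <= q by rewrite divr_ge0 ?mulr_ge0 // ?(ltW N0) //; lra.
have -> : P * (1 + S * (14 * m%:R * Lam) / N) * E - P = P * ((E - 1) + 14 * S * q * E).
  by rewrite /q; field; rewrite gt_eqF.
(* 31 = 17 + 14 from e and lam; 19 = 2 + 17 from P and E *)
have -> : 31 * S * expR (19 * S) * (m%:R * Lam / N) =
   expR (2 * S) * (17 * S * q * expR (17 * S) + 14 * S * q * expR (17 * S)).
  have -> : 19 * S = 2 * S + 17 * S by ring.
  by rewrite expRD /q; ring.
have Eone : 1 <= E.
  rewrite /E; elim/big_ind: _ => // [x y x1 y1|j _]; first exact: mulr_ege1.
  by rewrite lerDl mulr_ge0 // ltW.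
have K0 : 0 <= 14 * S * q by rewrite (mulr_ge0 _ q0) // mulr_ge0.
apply: ler_pM => //; last by rewrite lerD // ler_wpM2l.
by rewrite addr_ge0 ?subr_ge0 // mulr_ge0.
Qed.

(** [lattice_sum_tail] with t q = q^-alpha.  Since g_j^alpha 2^w_j is at most
    (g_j 2^w_j)^alpha, the sum over j is bounded by S^alpha whatever d is. *)
Lemma outside_box_le g w z alpha S : 1 < alpha -> (forall j, 0 < g j) ->
  (forall j, odd (z j)) -> 0 <= S ->
  (forall n, \sum_(j < n) g j * 2 ^+ w j <= S) ->
  forall zeta : R, 0 <= zeta -> 
  (forall n, \sum_(1 <= q < n) (q%:R `^ alpha)^-1 <= zeta) ->
  forall m d n,
  lattice_sum_nz (2 ^ m) n (decay_weight alpha (fun j => g j `^ alpha))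
    (fun j => (2 ^ w j * z j)%N%:Z) d 0 <=
  lattice_sum_nz (2 ^ m) (2 ^ m) (decay_weight alpha (fun j => g j `^ alpha))
    (fun j => (2 ^ w j * z j)%N%:Z) d 0 +
   2 * zeta * S `^ alpha * expR (2 * zeta * S `^ alpha) / (2 ^ m)%N%:R `^ alpha.
Proof.
move=> a1 g0 zo S0 hS zeta z0 hz m d n.
set phi := decay_weight _ _; set Z := fun j : nat => _.
have N0 : (0 < 2 ^ m)%N by rewrite expn_gt0.
have pa j : 0 < g j `^ alpha by apply: powR_gt0.
have phi0 j a : 0 <= phi j a by apply: decay_weight_ge0.
have Na : 0 < (2 ^ m)%N%:R `^ alpha :> R by rewrite powR_gt0 // ltr0n.
have gS : \sum_(j < d) g j `^ alpha * 2 ^+ w j <= S `^ alpha.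
  apply: (@le_trans _ _ (\sum_(j < d) (g j * 2 ^+ w j) `^ alpha)).
    apply: ler_sum => j _; rewrite powRM ?exprn_ge0 ?(ltW (g0 _)) //.
    by rewrite ler_wpM2l ?powR_ge0 // le1r_powR ?exp2_ge1 // ltW.
  apply: le_trans (powR_superadd_sum _ _) _ => [|j|]; first exact: ltW.
    by rewrite mulr_ge0 ?exprn_ge0 // ltW.
  rewrite ge0_ler_powR ?nnegrE //; first by lra.
  by apply: sumr_ge0 => j _; rewrite mulr_ge0 ?exprn_ge0 // ltW.
have gS1 : \sum_(j < d) g j `^ alpha <= S `^ alpha.
  apply: le_trans gS; apply: ler_sum => j _.
  by rewrite ler_peMr ?exp2_ge1 // ltW.
pose Q := n.+1.
apply: (@le_trans _ _ (lattice_sum_nz (2 ^ m) (Q * 2 ^ m) phi Z d 0)).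
  apply: lattice_sum_nz_le => //; rewrite /Q (leq_trans (leqnSn n)) //.
  by rewrite leq_pmulr.
rewrite /lattice_sum_nz addrAC lerD2r.
have := @lattice_sum_tail R m Q phi (fun j => g j `^ alpha / (2 ^ m)%N%:R `^ alpha)
  (fun q => (q%:R `^ alpha)^-1) zeta w z Z d 0.
move=> /(_ isT phi0 (fun j => erefl _)) h.
apply: le_trans (h _ _ zo (fun j => erefl _) _ (hz Q)) _.
- by move=> j; rewrite divr_ge0 // powR_ge0.
- by move=> q; rewrite invr_ge0 powR_ge0.
- move=> j q r q0; rewrite /phi /decay_weight /= -mulrA ler_wpM2l ?(ltW (pa _)) //.
  rewrite -invfM -powRM // lef_pV2 ?posrE ?powR_gt0 ?mulr_gt0 ?ltr0n //.
  rewrite ge0_ler_powR ?nnegrE ?mulr_ge0 //; first by lra.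
  by rewrite -natrM ler_nat mulnC (leq_trans (leq_addr r _)).
rewrite lerD2l; set M := \prod_(j < d) _.
have M0 : 0 <= M.
  by apply: prodr_ge0 => j _; rewrite (le_trans _ (coord_mass_ge1 _ _ _ _)).
have MS : M <= expR (2 * zeta * S `^ alpha).
  apply: (@le_trans _ _ (\prod_(j < d) (1 + 2 * zeta * g j `^ alpha))).
    apply: ler_prod => j _; rewrite (le_trans _ (coord_mass_ge1 _ _ _ _)) //=.
    rewrite /coord_mass lerD // -mulr_sumr -mulrA ler_wpM2l //.
    rewrite mulrC /phi /decay_weight /= -mulr_sumr ler_wpM2l ?(ltW (pa _)) //.
    by apply: le_trans (hz (Q * 2 ^ m).+1); rewrite big_add1 big_mkord.
  apply: le_trans (prod_1D_le_expR _ _ _) _ => [j|]; first by rewrite !mulr_ge0 // ltW.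
  by rewrite ler_expR -mulr_sumr ler_wpM2l // mulr_ge0.
have VS : \sum_(j < d) 2 * (g j `^ alpha / (2 ^ m)%N%:R `^ alpha) * zeta * 2 ^+ w j <=
    2 * zeta * S `^ alpha / (2 ^ m)%N%:R `^ alpha.
  rewrite (eq_bigr (fun j : 'I_d => 2 * zeta / (2 ^ m)%N%:R `^ alpha *
    (g j `^ alpha * 2 ^+ w j))) => [|j _]; last by ring.
  rewrite -mulr_sumr [leRHS]mulrAC ler_wpM2l // !mulr_ge0 // invr_ge0 powR_ge0 //.
have V0 : 0 <= \sum_(j < d) 2 * (g j `^ alpha / (2 ^ m)%N%:R `^ alpha) * zeta * 2 ^+ w j.
  by apply: sumr_ge0 => j _; rewrite !mulr_ge0 ?exprn_ge0 ?invr_ge0 ?powR_ge0.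
by rewrite [leRHS]mulrAC ler_pM.
Qed.

End ErrorBound.

(** * Assembly of the bound *)

Section Assembly.
Context {R : realType}.
Implicit Types (g : nat -> R) (w : nat -> nat) (alpha delta : R).

Lemma wce_reduced_cbc_dbd g w alpha : w 0%N = 0%N ->
  (forall j, (w j <= w j.+1)%N) -> (forall j, 0 < g j) ->
  (\sum_(0 <= j <oo) (g j * 2%:R ^+ w j)%:E < +oo)%E -> 1 < alpha ->
  exists2 C1 : R, 0 < C1 &
  forall delta, 0 < delta -> exists2 C2 : R, 0 < C2 &
  forall d m, (0 < m)%N -> forall Z : 'rV[int]_d, reduced_cbc_dbd g w m Z ->
  (wce (2 ^ m) alpha (fun j => g j `^ alpha)%R Z <=
   (1 / (2 ^ m)%N%:R `^ alpha *
     (C1 + C2 * (2 ^ m)%N%:R `^ (alpha * delta)))%:E)%E.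
Proof.
move=> w0 wm g0 fin a1.
have gw0 j : 0 <= g j * 2 ^+ w j by rewrite mulr_ge0 ?exprn_ge0 // ltW.
have [S S0 hS] := nneseries_partial_le gw0 fin.
have [zeta z0 hz] := zeta_bound a1.
exists (1 + 2 * zeta * S `^ alpha * expR (2 * zeta * S `^ alpha)).
  by rewrite ltr_pwDl // !mulr_ge0 ?powR_ge0 ?expR_ge0.
set C1 := 2 * zeta * S `^ alpha * _.
move=> delta d0; pose theta := delta * ln 2 / 2.
have ln2 : 0 < ln 2 :> R by rewrite ln_gt0 //; lra.
have t0 : 0 < theta by rewrite divr_gt0 // mulr_gt0.
have u0 j : 0 <= g j * 14 by rewrite mulr_ge0 // ltW.
have uS n : \sum_(j < n) g j * 14 <= S * 14.
  rewrite -mulr_suml ler_wpM2r //; apply: le_trans (hS n); apply: ler_sum => j _.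
  by rewrite ler_peMr ?exp2_ge1 // ltW.
have [C C0 hC] := prod_growth u0 uS t0.
pose K := 31 * S * expR (19 * S) * (C / theta).
have K0 : 0 <= K by rewrite !mulr_ge0 ?expR_ge0 // ?invr_ge0 ltW.
exists (1 + K `^ alpha); first by rewrite ltr_pwDl // powR_ge0.
move=> d m m0 Z hZ.
have [z [zo ZE good]] := reduced_cbc_dbd_good w0 wm g0 m0 hZ.
set N : R := (2 ^ m)%N%:R.
have N1 : 1 <= N by rewrite /N ler1n expn_gt0.
have Na : 0 < N `^ alpha by rewrite powR_gt0 //; lra.
have ga j : 0 < g j `^ alpha by apply: powR_gt0.
apply: wce_le => [j|n]; first exact: ltW.
set phi := decay_weight _ _.
have ext n' : lattice_sum_nz (2 ^ m) n' phi (entry Z) d 0 =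
    lattice_sum_nz (2 ^ m) n' phi (fun j => (2 ^ w j * z j)%N%:Z) d 0.
  by rewrite /lattice_sum_nz; congr (_ - _); apply: lattice_sum_ext => j /ZE.
rewrite ext; apply: le_trans (outside_box_le a1 g0 zo S0 hS z0 hz m d n) _.
rewrite -/phi -/C1 -/N.
pose Lam := C * expR (theta * m%:R).
have hLam s : (s <= d)%N -> \prod_(j < s) (1 + g j * (14 * m%:R)) <= Lam.
  by move=> _; apply: le_trans (hC s m); under eq_bigr => j _ do rewrite mulrA.
have box := box_sum_le g0 wm zo m0 hS hLam good.
have mexp : m%:R <= expR (theta * m%:R) / theta.
  rewrite ler_pdivlMr // mulrC; apply: le_trans (expR_ge1Dx _).
  by rewrite lerDr.
have Ndelta : expR (theta * m%:R) * expR (theta * m%:R) = N `^ delta.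
  rewrite -expRD /powR gt_eqF; last by lra.
  rewrite /N natrX lnXn // -[ln 2 *+ m]mulr_natl /theta; congr expR; by field.
have boxN : lattice_sum_nz (2 ^ m) (2 ^ m) (decay_weight 1 g)
    (fun j => (2 ^ w j * z j)%N%:Z) d 0 <= K * N `^ delta / N.
  apply: (le_trans box); rewrite /K -Ndelta /Lam /N natrX !mulrA.
  rewrite ler_wpM2r ?invr_ge0 ?exprn_ge0 //.
  have h0 : 0 <= 31 * S * expR (19 * S) * C * expR (theta * m%:R).
    by rewrite !mulr_ge0 ?expR_ge0 // ltW.
  by have := ler_wpM2l h0 mexp; lra.
have phiE : phi = fun j a => decay_weight 1 g j a `^ alpha.
  by apply/funext => j; apply/funext => a; apply: decay_weight_powR.
have small : lattice_sum_nz (2 ^ m) (2 ^ m) phi (fun j => (2 ^ w j * z j)%N%:Z) d 0 <=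
    K `^ alpha * N `^ (alpha * delta) / N `^ alpha.
  rewrite phiE; apply: le_trans (lattice_sum_nz_powR _ _ _ _ _ (ltW a1) _ _) _ => //.
    by move=> j a; apply: decay_weight_ge0.
  have N0 : 0 <= N by lra.
  have KN0 : 0 <= K * N `^ delta by rewrite (mulr_ge0 K0) // powR_ge0.
  have iN0 : 0 <= N^-1 by rewrite invr_ge0.
  have e : K `^ alpha * N `^ (alpha * delta) / N `^ alpha = (K * N `^ delta / N) `^ alpha.
    rewrite (powRM _ KN0 iN0) (powRM _ K0 (powR_ge0 _ _)).
    by rewrite -[N^-1]powR_inv1 // -!powRrM mulN1r powRN [delta * _]mulrC.
  rewrite e ge0_ler_powR ?nnegrE //; first by lra.
    by apply: lattice_sum_nz_ge0 => j a; apply: decay_weight_ge0.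
  exact: mulr_ge0.
have Nad : 0 <= N `^ (alpha * delta) by apply: powR_ge0.
apply: le_trans (lerD small (lexx _)) _.
rewrite -mulrDl mulrC mul1r ler_wpM2l ?invr_ge0 ?(ltW Na) //.
have : 0 <= K `^ alpha by apply: powR_ge0.
rewrite mulrDl mul1r; lra.
Qed.

End Assembly.

Theorem corollary1 (R : realType) (w : nat -> nat) (gamma : nat -> R)
  (w0 : w 0%N = 0%N) (w_mono : forall j : nat, (w j <= w j.+1)%N)
  (gamma_gt0 : forall j : nat, 0 < gamma j) :
  ((\sum_(0 <= j <oo) (gamma j * 2%:R ^+ w j)%:E < +oo)%E ->
   forall alpha : R, 1 < alpha ->
   exists2 C1 : R, 0 < C1 &
   forall delta : R, 0 < delta ->
   exists2 C2 : R, 0 < C2 &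
   forall d m : nat, (0 < d)%N -> (0 < m)%N ->
   forall z : 'rV[int]_d, reduced_cbc_dbd gamma w m z ->
   (wce (2 ^ m) alpha (fun j : nat => gamma j `^ alpha)%R z <=
    (1 / (2 ^ m)%N%:R `^ alpha *
     (C1 + C2 * (2 ^ m)%N%:R `^ (alpha * delta)))%:E)%E)
  /\
  (forall alpha : R, 1 < alpha ->
   (\sum_(0 <= j <oo) (gamma j `^ (1 / alpha) * 2%:R ^+ w j)%:E < +oo)%E ->
   exists2 F1 : R, 0 < F1 &
   forall delta : R, 0 < delta ->
   exists2 F2 : R, 0 < F2 &
   forall d m : nat, (0 < d)%N -> (0 < m)%N ->
   forall z : 'rV[int]_d,
   reduced_cbc_dbd (fun j : nat => gamma j `^ (1 / alpha)) w m z ->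
   (wce (2 ^ m) alpha gamma z <=
    (1 / (2 ^ m)%N%:R `^ alpha *
     (F1 + F2 * (2 ^ m)%N%:R `^ (alpha * delta)))%:E)%E).
Proof.
split=> [fin alpha a1 | alpha a1 fin].
  have [C1 C10 h1] := wce_reduced_cbc_dbd w0 w_mono gamma_gt0 fin a1.
  exists C1 => // delta d0; have [C2 C20 h2] := h1 delta d0.
  by exists C2 => // d m _; apply: h2.
have g0 j : 0 < gamma j `^ (1 / alpha) by apply: powR_gt0.
have gE : (fun j => (gamma j `^ (1 / alpha)) `^ alpha) = gamma.
  apply/funext => j; rewrite -powRrM div1r mulVf ?powRr1 ?ltW //.
  by rewrite gt_eqF //; lra.
have [C1 C10 h1] := wce_reduced_cbc_dbd w0 w_mono g0 fin a1.
exists C1 => // delta d0; have [C2 C20 h2] := h1 delta d0.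
by exists C2 => // d m _ m0 z hz; have := h2 d m m0 z hz; rewrite gE.
Qed.
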